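(* Let $(\mathcal A,\alpha)$ be an operator ideal and $X$ a Banach space. If the dual space $X^*$ has the $\mathcal A$-approximation property, then for every Banach space $Y$ we have $$\mathcal K\circ\mathcal A^{dual}(X,Y)\subset\overline{\mathcal F(X,Y)}^{\,{}_\kappa\alpha^d},$$ i.e. the finite rank operators are dense in $\mathcal K\circ\mathcal A^{dual}(X,Y)$ with respect to ${}_\kappa\alpha^d$. The converse holds if, in addition, $\mathcal A\subset\mathcal A^{dual\,dual}$ (equivalently, $\mathcal A^{dual\,dual}=\mathcal A^{reg}$).
   Context: Operator ideals are quasi-normed operator ideals $(\mathcal A,\alpha)$ between Banach spaces in the sense of Pietsch. $\mathcal K$ and $\mathcal F$ denote the compact and the finite rank operators. $B_X$ is the closed unit ball of $X$. Dual ideal: $T\in\mathcal A^{dual}(X,Y)$ iff $T^*\in\mathcal A(Y^*,X^* )$, with $\alpha^{dual}(T)=\alpha(T^* )$; $\mathcal A^{dual\,dual}=(\mathcal A^{dual})^{dual}$. Regular hull: $T\in\mathcal A^{reg}(X,Y)$ iff $\kappa_Y\circ T\in\mathcal A(X,Y^{**})$, where $\kappa_Y:Y\to Y^{**}$ is the canonical embedding. Composition: $T\in\mathcal A_1\circ\mathcal A_2(X,Y)$ iff $T=U\circ V$ with $V\in\mathcal A_2(X,Z)$, $U\in\mathcal A_1(Z,Y)$ for some Banach space $Z$. The composition norm on $\mathcal A\circ\mathcal K$ is $\alpha_\kappa(T)=\inf\{\alpha(T_1)\|T_2\|:T=T_1\circ T_2,\ T_1\in\mathcal A,\ T_2\in\mathcal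 K\}$, and the composition norm on $\mathcal K\circ\mathcal A^{dual}$ is ${}_\kappa\alpha^d(T)=\inf\{\|T_1\|\,\alpha^{dual}(T_2):T=T_1\circ T_2,\ T_1\in\mathcal K,\ T_2\in\mathcal A^{dual}\}$. $\mathcal A$-approximation property: for a compact subset $K$ of a Banach space $E$, call a Banach space $Z$ admissible for $(E,K)$ if $Z$ is a linear subspace of $E$ with its own complete norm such that the formal inclusion $i_Z:Z\to E$ is a compact operator, $K\subset i_Z(B_Z)$, and for every $g\in Z^*$ and $\epsilon>0$ there is $f\in E^*$ with $|f(z)-g(z)|<\epsilon$ for all $z\in B_Z$ (such $Z$ always exist). For $T\in\mathcal A(E,G)$ put $\|T\|_K=\inf\{\alpha_\kappa(T\circ i_Z): Z\text{ admissible for }(E,K)\}$. The family $\{\|\cdot\|_K: K\subset E\text{ compact}\}$ defines the topology $\lambda_{\mathcal A}$ on $\mathcal A(E,G)$. A Banach space $W$ has the $\mathcal A$-approximation property if for every Banach space $Y$, $\mathcal F(Y,W)$ is dense in $\mathcal A(Y,W)$ in the topology $\lambda_{\mathcal A}$. *)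

(* Defs.v *)
From HB Require Import structures.
From mathcomp Require Import all_boot all_order all_algebra.
From mathcomp Require Import all_classical all_reals all_analysis.
From mathcomp Require Import complex.

Set Implicit Arguments.
Unset Strict Implicit.
Unset Printing Implicit Defensive.

Import Order.TTheory GRing.Theory Num.Theory.
Import numFieldNormedType.Exports.

Local Open Scope classical_set_scope.
Local Open Scope ring_scope.

Variant scalar_kind := RealScalars | ComplexScalars.

Definition scalars (R : realType) (k : scalar_kind) : numFieldType :=
  match k with RealScalars => R | ComplexScalars => R[i] end.

Notation Banach R k := (completeNormedModType (scalars R k)).

Section Scalars.
Context {R : realType} {k : scalar_kind}.

(* In a normedModType over R[i] the norm is an element of R[i]; [sre] and [sofR]
   move between it and the real number it represents. *)
Definition sre : scalars R k -> R :=
  match k return scalars R k -> R with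
  | RealScalars => id | ComplexScalars => @complex.Re R
  end.

Definition sofR : R -> scalars R k :=
  match k return R -> scalars R k with
  | RealScalars => id | ComplexScalars => real_complex R
  end.

Lemma sofRK : cancel sofR sre.
Proof. by rewrite /sofR /sre; case: k. Qed.

Lemma sreK (x : scalars R k) : 0 <= x -> sofR (sre x) = x.
Proof.
rewrite /sofR /sre; case: k x => //= -[a b] /=.
by rewrite lecE/= => /andP[/eqP -> _].
Qed.

Lemma sofRD x y : sofR (x + y) = sofR x + sofR y.
Proof. by rewrite /sofR; case: k => //; rewrite rmorphD. Qed.

Lemma sofRM x y : sofR (x * y) = sofR x * sofR y.
Proof. by rewrite /sofR; case: k => //; rewrite rmorphM. Qed.

Lemma sofR0 : sofR 0 = 0.
Proof. by rewrite /sofR; case: k. Qed.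

Lemma ler_sofR x y : (sofR x <= sofR y) = (x <= y).
Proof. by rewrite /sofR; case: k => //=; rewrite lecR. Qed.

Lemma ltr_sofR x y : (sofR x < sofR y) = (x < y).
Proof. by rewrite /sofR; case: k => //=; rewrite ltcR. Qed.

Lemma sre_ge0 (x : scalars R k) : 0 <= x -> 0 <= sre x.
Proof. by move=> x0; rewrite -ler_sofR sofR0 sreK. Qed.

End Scalars.

Lemma complex_complete (R : realType) (F : set_system (R[i])^o) :
  ProperFilter F -> cauchy F -> cvg F.
Proof.
move=> FF Fc.
have Re_le (z : R[i]) : `|complex.Re z| <= complex.Re `|z|.
  by have := normc_ge_Re z; rewrite lecE => /andP[_].
have Im_le (z : R[i]) : `|complex.Im z| <= complex.Re `|z|.
  rewrite normc_def/= -sqrtr_sqr ler_wsqrtr// lerDr; exact: sqr_ge0.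
have ReB (z w : R[i]) : complex.Re (z - w) = complex.Re z - complex.Re w.
  by case: z w => [? ?] [? ?].
have ImB (z w : R[i]) : complex.Im (z - w) = complex.Im z - complex.Im w.
  by case: z w => [? ?] [? ?].
have part (p : R[i] -> R) : (forall z w, p (z - w) = p z - p w) ->
    (forall z, `|p z| <= complex.Re `|z|) -> cvg (p @ F).
  move=> pB ple; apply: cauchy_cvg; apply/cauchyP => e e0.
  have /(_ e%:C%C) := (@cauchyP R[i] (R[i])^o F FF).1 Fc.
  rewrite ltcR => /(_ e0)[z Fz]; exists (p z).
  rewrite /nbhs/=; apply: filterS Fz => w /=.
  rewrite -!ball_normE/= => zw.
  rewrite -pB; apply: (le_lt_trans (ple _)).
  by move: zw; rewrite ltcE/= => /andP[_].
have /cvg_ex[a Fa] := part _ ReB Re_le.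
have /cvg_ex[b Fb] := part _ ImB Im_le.
apply/cvg_ex; exists (a +i* b)%C.
apply/cvgrPdist_lt => e e0.
have abE z : (a +i* b)%C - z =
    (a - complex.Re z)%:C%C + (0 +i* (b - complex.Im z))%C.
  by case: z => x y; apply/eqP; rewrite eq_complex/= addr0 add0r !eqxx.
have [d d0 ->] : exists2 d : R, 0 < d & e = d%:C%C.
  by case: e e0 => x y; rewrite ltcE/= => /andP[/eqP -> x0]; exists x.
have d20 : 0 < d / 2 by rewrite divr_gt0.
move/cvgrPdist_lt : Fa => /(_ _ d20) Fa.
move/cvgrPdist_lt : Fb => /(_ _ d20) Fb.
move: Fa Fb; rewrite !near_map => Fa Fb; near=> z.
rewrite abE; apply: (le_lt_trans (ler_normD _ _)).
rewrite !normc_def/= expr0n/= addr0 add0r !sqrtr_sqr -rmorphD ltcR.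
rewrite (splitr d) ltrD//.
- by near: z.
- by near: z.
Unshelve. all: by end_near. Qed.

(* The scalar field as a one-dimensional Banach space; an alias, because the
   library already attaches completeness of [R : realType] to [R^o]. *)
Definition sline (R : realType) (k : scalar_kind) := (scalars R k)^o.

HB.instance Definition _ R k := NormedModule.copy (sline R k) (scalars R k)^o.

Lemma sline_complete (R : realType) k (F : set_system (sline R k)) :
  ProperFilter F -> cauchy F -> cvg F.
Proof. by case: k F; [exact: R_complete|exact: complex_complete]. Qed.

HB.instance Definition _ (R : realType) k :=
  Uniform_isComplete.Build (sline R k) (@sline_complete R k).

Definition nrm {R : realType} {k} {X : normedModType (scalars R k)} (x : X) : R :=
  sre `|x|.

Definition unit_ball {R : realType} {k} (X : normedModType (scalars R k)) :
  set X := [set x | `|x| <= 1].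
Arguments unit_ball {R k} X.

Section BoundedOperators.
Context {R : realType} {k : scalar_kind} (X Y : Banach R k).

Definition bounded_operator : {pred X -> Y} :=
  [pred T : X -> Y | `[< linear T /\ continuous T >]].

Record bop := Bop { bop_fun :> X -> Y; bop_mem : bop_fun \in bounded_operator }.

HB.instance Definition _ := [isSub of bop for bop_fun].
HB.instance Definition _ := [Choice of bop by <:].

Lemma bopE (f : X -> Y) :
  (f \in bounded_operator) = `[< linear f /\ continuous f >].
Proof. by []. Qed.

Lemma bounded_operator_submod : submod_closed bounded_operator.
Proof.
split=> [|a f g]; rewrite !bopE.
  apply/asboolP; split=> [c x y /=|x]; last exact: cvg_cst.
  by rewrite scaler0 addr0.
move=> /asboolP[lf cf] /asboolP[lg cg]; apply/asboolP; split=> [c x y|x].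
  rewrite !fctE lf lg.
  rewrite !scalerDr !scalerA (mulrC a c) -!addrA; congr (_ + _).
  by rewrite addrCA.
by apply: cvgD; [apply: cvgZr; exact: cf|exact: cg].
Qed.

HB.instance Definition _ := GRing.isSubmodClosed.Build (scalars R k) (X -> Y)
  bounded_operator bounded_operator_submod.
HB.instance Definition _ := [SubChoice_isSubLmodule of bop by <:].

Lemma bop_linear (T : bop) : linear T.
Proof. by case: T => T /= /asboolP[]. Qed.

Lemma bop_continuous (T : bop) : continuous T.
Proof. by case: T => T /= /asboolP[]. Qed.

HB.instance Definition _ (T : bop) :=
  GRing.isLinear.Build (scalars R k) X Y *:%R T (bop_linear T).

Definition opnorm (T : bop) : R := sup [set nrm (T x) | x in unit_ball X].

Lemma opnorm_has_sup (T : bop) :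
  has_sup [set nrm (T x) | x in unit_ball X].
Proof.
split; first by exists (nrm (T 0)), 0 => //; rewrite /unit_ball/= normr0.
have /linear_bounded_continuous/linear_boundedP/pinfty_ex_gt0[M M0 TM] :=
  @bop_continuous T.
exists (sre M) => _ [x x1 <-].
rewrite -(@ler_sofR R k) /nrm !sreK// ?(ltW M0)//.
by rewrite (le_trans (TM x))// ler_piMr// ltW.
Qed.

Lemma opnorm_ge0 (T : bop) : 0 <= opnorm T.
Proof.
apply: (@le_trans _ _ (nrm (T 0))); first exact: sre_ge0.
apply: ub_le_sup; first by have [] := opnorm_has_sup T.
by exists 0 => //; rewrite /unit_ball/= normr0.
Qed.

Lemma ler_opnorm (T : bop) x : `|T x| <= sofR (opnorm T) * `|x|.
Proof.
have [->|x0] := eqVneq x 0; first by rewrite linear0 !normr0 mulr0.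
have x_gt0 : 0 < `|x| by rewrite normr_gt0.
have Tx : `|T x| / `|x| = `|T (`|x|^-1 *: x)|.
  by rewrite linearZ/= normrZ ger0_norm ?invr_ge0// mulrC.
rewrite -ler_pdivrMr// Tx -[leLHS]sreK// ler_sofR.
apply: ub_le_sup; first by have [] := opnorm_has_sup T.
exists (`|x|^-1 *: x) => //.
by rewrite /unit_ball/= normfZV.
Qed.

Lemma opnorm_le (T : bop) (c : scalars R k) :
  (forall x, `|x| <= 1 -> `|T x| <= c) -> sofR (opnorm T) <= c.
Proof.
move=> Tc.
have c0 : 0 <= c.
  by apply: (le_trans (normr_ge0 (T 0))); apply: Tc; rewrite normr0.
rewrite -(sreK c0) ler_sofR; apply: ge_sup.
  by have [] := opnorm_has_sup T.
by move=> _ [x x1 <-]; rewrite -(@ler_sofR R k) /nrm !sreK//; exact: Tc.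
Qed.

Let bop_norm (T : bop) : scalars R k := sofR (opnorm T).

Let bop_norm_ge0 (T : bop) : 0 <= bop_norm T.
Proof. by rewrite -(@sofR0 R k) ler_sofR opnorm_ge0. Qed.

Let bop_norm_ball (T : bop) x : `|x| <= 1 -> `|T x| <= bop_norm T.
Proof.
move=> x1; rewrite (le_trans (ler_opnorm _ _))//.
by apply: ler_piMr => //; exact: bop_norm_ge0.
Qed.

Lemma opnormD_subproof (S T : bop) : bop_norm (S + T) <= bop_norm S + bop_norm T.
Proof.
apply: opnorm_le => x x1; rewrite (le_trans (ler_normD _ _))//.
by rewrite lerD// bop_norm_ball.
Qed.

Lemma opnorm_eq0_subproof (T : bop) : bop_norm T = 0 -> T = 0.
Proof.
move=> T0; apply/val_inj/funext => x; apply/eqP; rewrite -normr_le0.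
by have := ler_opnorm T x; rewrite -/(bop_norm T) T0 mul0r.
Qed.

Lemma opnormZ_subproof l (T : bop) : bop_norm (l *: T) = `|l| * bop_norm T.
Proof.
have le c (S : bop) : bop_norm (c *: S) <= `|c| * bop_norm S.
  by apply: opnorm_le => x x1; rewrite normrZ ler_wpM2l// bop_norm_ball.
have [->|l0] := eqVneq l 0.
  rewrite scale0r normr0 mul0r; apply/eqP; rewrite eq_le bop_norm_ge0 andbT.
  by apply: opnorm_le => x _; rewrite normr0.
apply/eqP; rewrite eq_le le/=.
have := le l^-1 (l *: T); rewrite scalerA mulVf// scale1r normfV.
by rewrite ler_pdivlMl// normr_gt0.
Qed.

HB.instance Definition _ := Lmodule_isNormed.Build (scalars R k) bop
  opnormD_subproof opnormZ_subproof opnorm_eq0_subproof.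

Lemma bop_normE (T : bop) : `|T| = sofR (opnorm T). Proof. by []. Qed.

Lemma bop_complete (F : set_system bop) : ProperFilter F -> cauchy F -> cvg F.
Proof.
move=> FF Fc.
have Fex := (@cauchyP _ bop F FF).1 Fc.
have ptF x : cauchy ((fun T : bop => T x) @ F).
  apply/cauchyP => e e0.
  have d0 : 0 < e / (`|x| + 1) by rewrite divr_gt0// ltr_wpDl.
  have [S FS] := Fex _ d0; exists (S x).
  change (F [set T : bop | ball (S x) e (T x)]).
  apply: filterS FS => T; rewrite -!ball_normE/= => ST.
  have -> : S x - T x = (S - T) x by [].
  rewrite (le_lt_trans (ler_opnorm _ _))// -bop_normE.
  apply: (@le_lt_trans _ _ (`|S - T| * (`|x| + 1))); first by rewrite ler_wpM2l// lerDl.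
  by rewrite -ltr_pdivlMr// ltr_wpDl.
have ptcv x := cauchy_cvg _ (ptF x).
pose L x := lim ((fun T : bop => T x) @ F).
have Lin : linear L.
  move=> a x y; apply: cvg_lim => //.
  rewrite (_ : (fun T : bop => T (a *: x + y)) = (fun T : bop => a *: T x + T y)).
    by apply: cvgD; [apply: cvgZr; exact: ptcv|exact: ptcv].
  by apply/funext => T; rewrite linearP.
have close (S : bop) e x : 0 < e -> F (ball S e) -> `|S x - L x| <= e * `|x|.
  move=> e0 FSe.
  have cv : (fun T : bop => `|S x - T x|) @ F --> `|S x - L x|.
    by apply: cvg_norm; apply: cvgB; [exact: cvg_cst|exact: ptcv].
  apply/ler_addgt0Pr => d d0.
  move/cvgrPdist_lt : cv => /(_ _ d0) cv.
  have [T []] := filter_ex (filterI cv FSe).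
  rewrite -ball_normE/= => Td STe.
  have ST : `|S x - T x| <= e * `|x|.
    have -> : S x - T x = (S - T) x by [].
    by rewrite (le_trans (ler_opnorm _ _))// ler_wpM2r// ltW.
  apply: (@le_trans _ _ (`|S x - T x| + d)); last by rewrite lerD2r.
  rewrite -lerBlDl (le_trans _ (ltW Td))//.
  by apply: real_ler_norm; rewrite realB// normr_real.
have Lcont : continuous L.
  pose HL := GRing.isLinear.Build (scalars R k) X Y *:%R L Lin.
  pose Ll : {linear X -> Y} := HB.pack L HL.
  have [S FS] := Fex 1 ltr01.
  suff : continuous Ll by [].
  apply/linear_bounded_continuous/linear_boundedP.
  near=> r => x.
  have -> : Ll x = S x - (S x - L x) by rewrite subKr.
  rewrite (le_trans (ler_normB _ _))//.
  apply: (@le_trans _ _ ((`|S| + 1) * `|x|)).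
    by rewrite mulrDl lerD ?close// ler_opnorm.
  by rewrite ler_wpM2r//; near: r; exact: nbhs_pinfty_ge.
have Lmem : L \in bounded_operator by rewrite bopE; apply/asboolP.
apply/cvg_ex; exists (Bop Lmem).
apply/cvgrPdist_lt => /= e e0.
have e2 : 0 < e / 2 by rewrite divr_gt0.
have [S FS] := Fex _ e2.
have SL : `|S - Bop Lmem| <= e / 2.
  rewrite bop_normE; apply: opnorm_le => x x1.
  have := close S _ x e2 FS => /le_trans; apply.
  by rewrite ler_piMr// ltW.
apply: filterS FS => T; rewrite -ball_normE/= => ST.
have -> : Bop Lmem - T = (S - T) - (S - Bop Lmem).
  by rewrite opprB [RHS]addrC addrA addrNK.
rewrite (le_lt_trans (ler_normB _ _))//.
by rewrite [ltRHS]splitr ltr_leD.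
Unshelve. all: by end_near. Qed.

HB.instance Definition _ := Uniform_isComplete.Build bop bop_complete.

End BoundedOperators.
Arguments bop {R k} X Y.
Arguments bounded_operator {R k} X Y.

Definition dual {R : realType} {k} (X : Banach R k) : Banach R k :=
  bop X (sline R k).

Section Operations.
Context {R : realType} {k : scalar_kind}.
Implicit Types X Y Z : Banach R k.

Lemma bcomp_subproof X Y Z (U : bop Y Z) (V : bop X Y) :
  U \o V \in bounded_operator X Z.
Proof.
rewrite bopE; apply/asboolP; split=> [a x y|x] /=; first by rewrite !linearP.
by apply: continuous_comp; exact: bop_continuous.
Qed.

Definition bcomp X Y Z (U : bop Y Z) (V : bop X Y) : bop X Z :=
  Bop (bcomp_subproof U V).

Lemma bid_subproof X : idfun \in bounded_operator X X.
Proof. by rewrite bopE; apply/asboolP; split=> // x; exact: cvg_id. Qed.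

Definition bid X : bop X X := Bop (bid_subproof X).

Lemma bop_of_bound_subproof X Y (f : X -> Y) (c : scalars R k) :
  0 <= c -> linear f -> (forall x, `|f x| <= c * `|x|) ->
  f \in bounded_operator X Y.
Proof.
move=> c0 lf fc; rewrite bopE; apply/asboolP; split=> //.
pose Hf := GRing.isLinear.Build (scalars R k) X Y *:%R f lf.
pose fl : {linear X -> Y} := HB.pack f Hf.
suff : continuous fl by [].
apply/linear_bounded_continuous/linear_boundedP.
near=> r => x; rewrite (le_trans (fc x))//.
rewrite ler_wpM2r//; near: r; apply: nbhs_pinfty_ge.
exact: ger0_real.
Unshelve. all: by end_near. Qed.

Lemma adjoint_subproof X Y (T : bop X Y) :
  (fun f : bop Y (sline R k) => bcomp f T) \in
    bounded_operator (dual Y) (dual X).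
Proof.
apply: (@bop_of_bound_subproof (dual Y) (dual X) _ `|T|) => //.
  by move=> a f g; apply/val_inj/funext.
move=> f; rewrite mulrC; apply: opnorm_le => x x1 /=.
rewrite (le_trans (ler_opnorm _ _))// ler_wpM2l ?(@normr_ge0 _ (dual Y))//.
by rewrite (le_trans (ler_opnorm _ _))// ler_piMr// (@normr_ge0 _ (bop X Y)).
Qed.

Definition adjoint X Y (T : bop X Y) : bop (dual Y) (dual X) :=
  Bop (adjoint_subproof T).

Lemma eval_subproof X (x : X) :
  (fun f : bop X (sline R k) => f x) \in
    bounded_operator (dual X) (sline R k).
Proof.
apply: (@bop_of_bound_subproof (dual X) (sline R k) _ `|x|) => //.
by move=> f; rewrite mulrC; exact: ler_opnorm.
Qed.

Lemma kappa_subproof X :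
  (fun x : X => Bop (eval_subproof x) : dual (dual X)) \in
    bounded_operator X (dual (dual X)).
Proof.
apply: (@bop_of_bound_subproof X (dual (dual X)) _ 1) => //.
- move=> a x y; apply/val_inj/funext => f /=; exact: linearP.
- move=> x; rewrite mul1r; apply: opnorm_le => f f1 /=.
  by rewrite (le_trans (ler_opnorm _ _))// ler_piMl.
Qed.

Definition kappa X : bop X (dual (dual X)) := Bop (kappa_subproof X).

Definition compact_op X Y : set (bop X Y) :=
  [set T | precompact (T @` unit_ball X)].

Definition finite_rank X Y : set (bop X Y) :=
  [set T | exists (n : nat) (y : 'I_n -> Y), forall x,
     exists c : 'I_n -> scalars R k, T x = \sum_(i < n) c i *: y i].

End Operations.

Definition opclass (R : realType) k := forall X Y : Banach R k, set (bop X Y).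
Definition opfun (R : realType) k := forall X Y : Banach R k, bop X Y -> R.

(* Only the values of [oi_norm] on [oi_mem] matter.  Homogeneity and
   definiteness of the quasi-norm follow from [oi_normM] and [oi_norm_id].
   Completeness of the components is not required. *)
Record operator_ideal (R : realType) (k : scalar_kind) := OperatorIdeal {
  oi_mem :> opclass R k;
  oi_norm : opfun R k;
  oi_id : oi_mem (bid (sline R k));
  oi_add : forall (X Y : Banach R k) (S T : bop X Y),
    oi_mem S -> oi_mem T -> oi_mem (S + T);
  oi_comp : forall (X0 X Y Y0 : Banach R k)
      (U : bop Y Y0) (S : bop X Y) (V : bop X0 X),
    oi_mem S -> oi_mem (bcomp U (bcomp S V));
  oi_norm_ge0 : forall (X Y : Banach R k) (S : bop X Y),
    oi_mem S -> 0 <= oi_norm S;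
  oi_norm_id : oi_norm (bid (sline R k)) = 1;
  oi_normD : exists2 c : R, 1 <= c &
    forall (X Y : Banach R k) (S T : bop X Y), oi_mem S -> oi_mem T ->
      oi_norm (S + T) <= c * (oi_norm S + oi_norm T);
  oi_normM : forall (X0 X Y Y0 : Banach R k)
      (U : bop Y Y0) (S : bop X Y) (V : bop X0 X),
    oi_mem S ->
    oi_norm (bcomp U (bcomp S V)) <= opnorm U * oi_norm S * opnorm V
}.

Section Classes.
Context {R : realType} {k : scalar_kind}.
Implicit Types (X Y Z : Banach R k) (C : opclass R k) (c : opfun R k).

Definition dual_class C : opclass R k :=
  fun X Y => [set T | C _ _ (adjoint T)].

Definition dual_norm c : opfun R k := fun X Y T => c _ _ (adjoint T).

Definition reg_class C : opclass R k :=
  fun X Y => [set T | C _ _ (bcomp (kappa Y) T)].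

Definition comp_class C1 C2 : opclass R k := fun X Y =>
  [set T | exists (Z : Banach R k) (U : bop Z Y) (V : bop X Z),
     [/\ C1 _ _ U, C2 _ _ V & T = bcomp U V]].

(* [+oo] when [T] is not in [comp_class C1 C2]. *)
Definition comp_norm C1 c1 C2 c2 X Y (T : bop X Y) : \bar R :=
  ereal_inf [set r | exists (Z : Banach R k) (U : bop Z Y) (V : bop X Z),
    [/\ C1 _ _ U, C2 _ _ V, T = bcomp U V & r = (c1 _ _ U * c2 _ _ V)%:E]].

Definition subclass C1 C2 : Prop := forall X Y, C1 X Y `<=` C2 X Y.

Definition eqclass C1 C2 : Prop := forall X Y, C1 X Y = C2 X Y.

Variable A : operator_ideal R k.

Definition norm_AK X Y (T : bop X Y) : \bar R :=
  comp_norm A (oi_norm A) (@compact_op R k) (@opnorm R k) T.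

Definition norm_KAd X Y (T : bop X Y) : \bar R :=
  comp_norm (@compact_op R k) (@opnorm R k)
    (dual_class A) (dual_norm (oi_norm A)) T.

(* A linear subspace of [E] with its own complete norm is given as a Banach
   space [Z] with an injective operator [i] into [E]. *)
Definition admissible (E : Banach R k) (Q : set E) (Z : Banach R k)
    (i : bop Z E) : Prop :=
  [/\ injective i, compact_op i, Q `<=` i @` unit_ball Z &
    forall (g : bop Z (sline R k)) (e : R), 0 < e ->
      exists f : bop E (sline R k),
        forall z, unit_ball Z z -> nrm (f (i z) - g z) < e].

Definition norm_on (E G : Banach R k) (Q : set E) (T : bop E G) : \bar R :=
  ereal_inf [set r | exists (Z : Banach R k) (i : bop Z E),
    admissible Q i /\ r = norm_AK (bcomp T i)].

(* [norm_on Q] is only a quasi-seminorm, so its balls need not be open: the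
   topology on [A E G] generated by the family of all [norm_on Q], [Q] compact,
   is the one in which finite intersections of balls centred at [T] form a base
   of neighbourhoods of [T]. *)
Definition lambda_nbhs (E G : Banach R k) (T : bop E G) :
    set_system (bop E G) :=
  [set U | exists (n : nat) (Q : 'I_n -> set E) (e : R),
    [/\ forall j, compact (Q j), 0 < e &
      forall S, oi_mem A S -> (forall j, (norm_on (Q j) (S - T)%R < e%:E)%E) -> U S]].

Definition approximation_property (W : Banach R k) : Prop :=
  forall (Y : Banach R k) (T : bop Y W), oi_mem A T ->
    forall U, lambda_nbhs T U -> U `&` @finite_rank R k Y W !=set0.

(* A finite [norm_KAd (T - S)] forces [T - S] into the composition ideal. *)
Definition finite_rank_closure (X Y : Banach R k) : set (bop X Y) :=
  [set T | forall e : R, 0 < e ->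
     exists2 S, finite_rank S & (norm_KAd (T - S)%R < e%:E)%E].

End Classes.

Arguments comp_class {R k} C1 C2 X Y.
Arguments compact_op {R k} X Y.
Arguments finite_rank_closure {R k} A X Y.

(* Main.v *)
(* Adjoints and duals are denoted by a prime.  Let T = U V with U compact and V'
   in A.  Factor U' = i0 J0 with i0 admissible and J0 compact, and approximate V'
   by a finite rank S on the image of i0: this gives an admissible i : W -> Z'
   with U' = i J and (S - V') i small in A o K.  By Goldstine's theorem S may be
   taken to be F', where F : X -> Z has finite rank.  With D = V - F and
   D' i = U1 V1, the operator Q : X -> W' predual to D' i satisfies Q' = U1 V2,
   where V2 extends the compact V1 to W'' with the same norm and the same target
   space, so that Q' is small in A.  Since the range of i' kappa_Z is dense in W',
   J' takes its values in Y and provides a compact P with U D = P Q.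
   Conversely, for T : Y -> X' in A and i : W -> Y admissible, i' T' kappa_X lies
   in K o A^dual because T'' is in A; a finite rank approximation of it may be
   taken of the form i' S1, and dualizing i' (T' kappa_X - S1) = P V gives
   (T - S1' kappa_Y) i = V' P' kappa_W. *)

From HB Require Import structures.
From mathcomp Require Import all_boot all_order all_algebra.
From mathcomp Require Import all_classical all_reals all_analysis.
From mathcomp Require Import complex ring lra.
Require Import Defs.

Set Implicit Arguments.
Unset Strict Implicit.
Unset Printing Implicit Defensive.

Import Order.TTheory GRing.Theory Num.Theory.
Import numFieldNormedType.Exports.

Local Open Scope classical_set_scope.
Local Open Scope ring_scope.

(** * Real-valued norms and the Hahn-Banach theorem *)

(** Three obstacles shape the argument. First, [oi_norm] is only a quasi-norm and no regularity of
    the ideal is available in the first implication. Sums therefore cost a constant, whence the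
    errors [e / c / 2], and U1 may only be composed with further operators, never replaced by its
    biadjoint. This is why V2 must keep the target space of V1. Second, W comes out of an infimum
    over admissible spaces and cannot be chosen, while J has to be compact. Compactness is thus
    secured beforehand in J0, and i only has to satisfy a ball inclusion through which i0 factors
    boundedly. Third, a finite rank operator from Z' to X' is built from elements of Z'' and need
    not be an adjoint. Goldstine's theorem moves these elements into Z only up to an error measured
    on a totally bounded set, here the image under i of the unit ball of W: what becomes small is (S
    - F') i, not S - F'. In the converse the density clause of admissibility does the same work,
    replacing functionals on W by restrictions of functionals on Y. *)

Section RealNorm.
Context {R : realType} {k : scalar_kind}.
Implicit Types (X Y : normedModType (scalars R k)) (a b : scalars R k).

Definition sabs a : R := sre `|a|.

Lemma sofR_sabs a : sofR (sabs a) = `|a|. Proof. exact: sreK. Qed.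

Lemma sofR_nrm X (x : X) : sofR (nrm x) = `|x|. Proof. exact: sreK. Qed.

Lemma sofR_inj : injective (@sofR R k).
Proof. exact: can_inj sofRK. Qed.

Lemma ler_nrm X Y (x : X) (y : Y) : (nrm x <= nrm y) = (`|x| <= `|y|).
Proof. by rewrite -(@ler_sofR R k) !sofR_nrm. Qed.

Lemma sabs_ge0 a : 0 <= sabs a. Proof. exact: sre_ge0. Qed.

Lemma nrm_ge0 X (x : X) : 0 <= nrm x. Proof. exact: sre_ge0. Qed.

Lemma nrmZ X a (x : X) : nrm (a *: x) = sabs a * nrm x.
Proof. by apply: sofR_inj; rewrite sofRM sofR_sabs !sofR_nrm normrZ. Qed.

Lemma ler_nrmD X (x y : X) : nrm (x + y) <= nrm x + nrm y.
Proof. by rewrite -(@ler_sofR R k) sofRD !sofR_nrm ler_normD. Qed.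

Lemma nrmN X (x : X) : nrm (- x) = nrm x.
Proof. by rewrite /nrm normrN. Qed.

Lemma nrmBC X (x y : X) : nrm (x - y) = nrm (y - x).
Proof. by rewrite /nrm distrC. Qed.

Lemma nrm0 X : nrm (0 : X) = 0.
Proof. by apply: sofR_inj; rewrite sofR_nrm normr0 sofR0. Qed.

Lemma nrm_eq0 X (x : X) : (nrm x == 0) = (x == 0).
Proof. by rewrite -(inj_eq sofR_inj) sofR_nrm sofR0 normr_eq0. Qed.

Lemma nrm_gt0 X (x : X) : (0 < nrm x) = (x != 0).
Proof. by rewrite lt_def nrm_ge0 andbT nrm_eq0. Qed.

Lemma ler_nrmB X (x y : X) : nrm (x - y) <= nrm x + nrm y.
Proof. by rewrite (le_trans (ler_nrmD _ _))// nrmN. Qed.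

Lemma ler_nrm_sum X n (F : 'I_n -> X) :
  nrm (\sum_i F i) <= \sum_i nrm (F i).
Proof.
elim/big_rec2: _ => [|i y x _ xy]; first by rewrite nrm0.
by rewrite (le_trans (ler_nrmD _ _))// lerD2l.
Qed.

Lemma nrm_triangle X (z x y : X) : nrm (x - y) <= nrm (x - z) + nrm (z - y).
Proof. by rewrite (le_trans _ (ler_nrmD _ _))// addrA addrNK. Qed.

Lemma nrm_sline (t : sline R k) : nrm t = sabs t. Proof. by []. Qed.

Lemma sabs_nrm a : sabs a = nrm (a : sline R k). Proof. by []. Qed.

Lemma sabsM a b : sabs (a * b) = sabs a * sabs b.
Proof. by apply: sofR_inj; rewrite sofRM !sofR_sabs normrM. Qed.

Lemma sabs0 : sabs (0 : scalars R k) = 0. Proof. exact: (nrm0 (sline R k)). Qed.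

Lemma sabs1 : sabs (1 : scalars R k) = 1.
Proof.
apply: sofR_inj; rewrite sofR_sabs normr1 /sofR; case: k => //=.
Qed.

Lemma sabsN a : sabs (- a) = sabs a. Proof. exact: (@nrmN (sline R k)). Qed.

Lemma sofR1 : sofR 1 = 1 :> scalars R k.
Proof. by rewrite -sabs1 sofR_sabs normr1. Qed.

Lemma sofRN (x : R) : sofR (- x) = - sofR x :> scalars R k.
Proof. by apply/eqP; rewrite -addr_eq0 -sofRD addNr sofR0. Qed.

Lemma sabs_sofR (x : R) : sabs (sofR x : scalars R k) = `|x|.
Proof.
apply: sofR_inj; rewrite sofR_sabs.
wlog x0 : x / 0 <= x => [H|].
  have [/H//|/ltW x0] := leP 0 x.
  by rewrite -normrN -sofRN H ?normrN// oppr_ge0.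
by rewrite !ger0_norm// -(@sofR0 R k) ler_sofR.
Qed.

Lemma sabs_eq0 a : (sabs a == 0) = (a == 0).
Proof. exact: (@nrm_eq0 (sline R k)). Qed.

Lemma sabsV a : sabs a^-1 = (sabs a)^-1.
Proof.
have [->|a0] := eqVneq a 0; first by rewrite invr0 sabs0 invr0.
apply: (@mulIf _ (sabs a)); first by rewrite sabs_eq0.
by rewrite -sabsM !mulVf ?sabs1 ?sabs_eq0.
Qed.

Lemma unit_ballE X (x : X) : unit_ball X x <-> nrm x <= 1.
Proof. by rewrite /unit_ball/= -(@ler_sofR R k) sofR_nrm sofR1. Qed.

Lemma sre_le_sabs a : sre a <= sabs a.
Proof.
rewrite /sabs /sre; case: k a => [a|[a b]] /=; first exact: ler_norm.
by rewrite (le_trans (ler_norm _))// -sqrtr_sqr ler_wsqrtr// lerDl sqr_ge0.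
Qed.

Lemma sreD a b : sre (a + b) = sre a + sre b.
Proof. by rewrite /sre; case: k a b => [a b|[? ?] [? ?]]. Qed.

Lemma sre_sofRM (t : R) a : sre (sofR t * a) = t * sre a.
Proof.
by rewrite /sre /sofR; case: k a => [//|[x y]] /=; rewrite mul0r subr0.
Qed.

Lemma exists_phase a : exists2 u, sabs u = 1 & u * a = sofR (sabs a).
Proof.
have [->|a0] := eqVneq a 0; first by exists 1; rewrite ?sabs1// mulr0 sabs0 sofR0.
exists (sofR (sabs a) / a); last by rewrite divfK.
by rewrite sabsM sabs_sofR sabsV ger0_norm ?sabs_ge0// mulfV// sabs_eq0.
Qed.

End RealNorm.

Definition seminorm {R : realType} {k} (V : lmodType (scalars R k)) (q : V -> R) :=
  (forall x y, q (x + y) <= q x + q y) /\ (forall a x, q (a *: x) = sabs a * q x).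

Section Seminorm.
Context {R : realType} {k : scalar_kind} (V : lmodType (scalars R k)) (q : V -> R).
Hypothesis qs : seminorm q.

Lemma semi0 : q 0 = 0.
Proof. by rewrite -(scale0r (0 : V)) qs.2 sabs0 mul0r. Qed.

Lemma semiN x : q (- x) = q x.
Proof. by rewrite -scaleN1r qs.2 sabsN sabs1 mul1r. Qed.

Lemma semi_ge0 x : 0 <= q x.
Proof.
have := qs.1 x (- x); rewrite subrr semi0 semiN -mulr2n pmulrn_lge0//.
Qed.

End Seminorm.

Section PlainLinear.
Context (K : pzRingType) (U V : lmodType K) (h : U -> V) (linh : linear h).

Lemma linear_fun_0 : h 0 = 0.
Proof.
by apply: (@addrI _ (h 0)); have := linh 1 0 0; rewrite !scale1r !addr0 => <-; rewrite ?addr0.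
Qed.

Lemma linear_fun_Z a x : h (a *: x) = a *: h x.
Proof. by have := linh a x 0; rewrite linear_fun_0 !addr0. Qed.

Lemma linear_fun_D x y : h (x + y) = h x + h y.
Proof. by have := linh 1 x y; rewrite !scale1r. Qed.

Lemma linear_fun_B x y : h (x - y) = h x - h y.
Proof. by have := linh (-1) y x; rewrite !scaleN1r [- y + x]addrC [- h y + _]addrC. Qed.

End PlainLinear.

(** Over the complex scalars the only candidate is [u x - i u (i x)]; over the reals it is [u]
    itself. Hahn-Banach can thus be proved once, for real-linear functionals. *)
Lemma exists_functional_of_re (R : realType) k (V : lmodType (scalars R k))
    (u : V -> R) : (forall x y t, u (x + sofR t *: y) = u x + t * u y) ->
  exists2 g : V -> sline R k, linear g & forall x, sre (g x) = u x.
Proof.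
case: k V u => V u ulin.
  by exists u => // a x y; have := ulin y x a; rewrite /= [y + _]addrC [u y + _]addrC.
pose i : R[i] := 'i%C.
have u0 : u 0 = 0.
  by apply: (@addrI _ (u 0)); have := ulin 0 0 1; rewrite /= scaler0 !addr0 mul1r => <-; rewrite ?addr0.
have uD x y : u (x + y) = u x + u y by have := ulin x y 1; rewrite /= scale1r mul1r.
have uZ t x : u (t%:C%C *: x) = t * u x by have := ulin 0 x t; rewrite u0 !add0r.
exists (fun x => (u x +i* - u (i *: x))%C) => // -[s t] x y.
have uC z : u ((s +i* t)%C *: z) = s * u z + t * u (i *: z).
  rewrite -!uZ -uD scalerA -scalerDl; congr (u (_ *: _)).
  by apply/eqP; rewrite eq_complex/=; apply/andP; split; apply/eqP; ring.
apply/eqP; rewrite eq_complex/=; apply/andP; split; apply/eqP.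
  by rewrite uD uC; ring.
rewrite scalerDr uD scalerA mulrC -scalerA uC scalerA.
rewrite (_ : i * i = (-1)%:C%C) ?uZ; last by rewrite -expr2 sqr_i rmorphN1.
by ring.
Qed.

(** If [t] rotates [f x - g x] onto its modulus, then [f - g] takes that modulus as its value at
    [t *: x]; the value is real, and its real part vanishes. *)
Lemma functional_eq_re (R : realType) k (V : lmodType (scalars R k))
    (f g : V -> sline R k) : linear f -> linear g ->
  (forall x, sre (f x) = sre (g x)) -> f =1 g.
Proof.
move=> linf ling fg x; apply/eqP; rewrite -subr_eq0 -nrm_eq0.
have [t t1 tfg] := exists_phase (f x - g x).
have key h : linear h -> t * h x = h (t *: x) :> sline R k.
  by move=> linh; rewrite (linear_fun_Z linh).
rewrite nrm_sline -[sabs _](@sofRK R k) -tfg mulrBr !key// sreD.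
rewrite [X in _ + X](_ : _ = - sre (g (t *: x))).
  by rewrite fg subrr.
by case: (k) (g _) => //= -[].
Qed.

(** * The Hahn-Banach theorem for a dominating seminorm, over both scalar fields *)

Section HahnBanach.
Context {R : realType} {k : scalar_kind} (V : lmodType (scalars R k)) (q : V -> R).
Hypothesis qs : seminorm q.

(** A real-linear functional on a subspace, dominated by [q], is encoded by its graph.
    Single-valuedness comes from the domination: the difference of two values at one point is a
    value at 0, hence at most [q 0 = 0]. *)
Let graph (G : set (V * R)) : Prop :=
  [/\ G (0, 0),
    forall x a y b t, G (x, a) -> G (y, b) -> G (x + sofR t *: y, a + t * b) &
    forall x a, G (x, a) -> a <= q x].

Lemma real_hahn_banach (G0 : set (V * R)) : graph G0 ->
  exists u : V -> R,
    [/\ forall x y t, u (x + sofR t *: y) = u x + t * u y,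
        forall x, u x <= q x & forall x a, G0 (x, a) -> u x = a].
Proof.
move=> gG0.
(* Joining [G0] to every member covers the empty chain, whose union is empty. *)
pose P := [set G | graph (G `|` G0)].
have [F FP Ftot|G [gG Gmax]] := @Zorn_bigcup _ P.
  have [->|/set0P[G1 FG1]] := eqVneq F set0.
    by rewrite /P/= bigcup_set0 set0U.
  rewrite /P/=; split.
  - by right; case: gG0.
  - have key (p1 p2 : V * R) : (\bigcup_(X in F) X `|` G0) p1 ->
      (\bigcup_(X in F) X `|` G0) p2 ->
      exists2 G, F G & (G `|` G0) p1 /\ (G `|` G0) p2.
      move=> [[G FG Gp1]|p10] [[H FH Hp2]|p20].
      + have [GH|HG] := Ftot _ _ FG FH.
          by exists H => //; split; left => //; exact: GH.
        by exists G => //; split; left => //; exact: HG.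
      + by exists G => //; split; [left|right].
      + by exists H => //; split; [right|left].
      + by exists G1 => //; split; right.
    move=> x a y b t xa yb; have [G FG [Gx Gy]] := key _ _ xa yb.
    have [_ GD _] := FP _ FG.
    by case: (GD _ _ _ _ t Gx Gy) => ?; [left; exists G|right].
  - move=> x a [[G FG Gx]|x0]; last by case: gG0 => _ _; exact.
    by case: (FP _ FG) => _ _; apply; left.
set H := G `|` G0 in gG.
case: gG => H0 HD Hq.
have HZ x a t : H (x, a) -> H (sofR t *: x, t * a).
  by move=> xa; have := HD _ _ _ _ t H0 xa; rewrite !add0r.
have total v : exists a, H (v, a).
  apply: contrapT => nv.
  pose S := [set s | exists x a, H (x, a) /\ s = a - q (x - v)].
  have Sub s y b : S s -> H (y, b) -> s <= q (y + v) - b.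
    move=> [x [a [xa ->]]] yb; rewrite lerBlDr addrAC lerBrDr.
    have := Hq _ _ (HD _ _ _ _ 1 xa yb); rewrite sofR1 scale1r mul1r => /le_trans.
    apply; rewrite (_ : x + y = (y + v) + (x - v)) ?qs.1//.
    by rewrite [x - v]addrC addrA addrK addrC.
  have S0 : S !=set0 by exists (0 - q (0 - v)), 0, 0.
  have Ss : has_sup S.
    by split=> //; exists (q (0 + v) - 0) => s Ss; exact: Sub Ss H0.
  (* A value at [v] is compatible with the domination when it lies above every [a - q (x - v)] and
     below every [q (y + v) - b]; [Sub] says that these bounds do not cross. *)
  pose c := sup S.
  have c_lo x a : H (x, a) -> a - q (x - v) <= c.
    by move=> xa; apply: ub_le_sup; [exact: Ss.2|exists x, a].
  have c_hi x a : H (x, a) -> c <= q (x + v) - a.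
    by move=> xa; apply: ge_sup => // s Hs; exact: Sub Hs xa.
  pose G' := [set p | exists x a t, H (x, a) /\ p = (x + sofR t *: v, a + t * c)].
  have HG' : H `<=` G'.
    by move=> [x a] xa; exists x, a, 0; rewrite sofR0 scale0r mul0r !addr0.
  apply: (Gmax G').
    split=> [p Gp|G'G]; first by apply: HG'; left.
    apply: nv; exists c; left; apply: G'G; exists 0, 0, 1.
    by rewrite sofR1 scale1r mul1r !add0r.
  rewrite /P/= setUidl; last by move=> p p0; apply: HG'; right.
  split; first exact: HG'.
    move=> _ _ _ _ t [x [a [s [xa [-> ->]]]]] [y [b [r [yb [-> ->]]]]].
    exists (x + sofR t *: y), (a + t * b), (s + t * r); split; first exact: HD.
    congr (_, _); last by ring.
    by rewrite sofRD sofRM scalerDr scalerDl scalerA addrACA.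
  move=> _ _ [x [a [t [xa [-> ->]]]]].
  have scal r y b s : 0 < r -> sofR r *: (y + sofR s *: v) = x + sofR t *: v ->
      r * b = a + t * c -> b <= q (y + sofR s *: v) -> a + t * c <= q (x + sofR t *: v).
    move=> r0 <- <- bq; rewrite qs.2 sabs_sofR gtr0_norm// ler_pM2l//.
  have [t0|t0|->] := ltgtP t 0.
  - apply: (@scal (- t) (sofR (- t)^-1 *: x) ((- t)^-1 * a - c) (-1)).
    + by rewrite oppr_gt0.
    + rewrite scalerDr !scalerA -!sofRM mulfV ?oppr_eq0 ?lt_eqF//.
      by rewrite sofR1 scale1r mulrN1 opprK.
    + by rewrite mulrBr mulrA mulfV ?oppr_eq0 ?lt_eqF// mul1r mulNr opprK.
    + rewrite sofRN sofR1 scaleN1r lerBlDr addrC -lerBlDr.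
      exact: c_lo (HZ _ _ _ xa).
  - apply: (@scal t (sofR t^-1 *: x) (t^-1 * a + c) 1) => //.
    + by rewrite scalerDr !scalerA -!sofRM mulfV ?gt_eqF// sofR1 scale1r mulr1.
    + by rewrite mulrDr mulrA mulfV ?gt_eqF// mul1r.
    + by rewrite sofR1 scale1r addrC -lerBrDr; exact: c_hi (HZ _ _ _ xa).
  - by rewrite sofR0 scale0r mul0r !addr0; exact: Hq.
have [u uH] := choice total.
have uniq x a b : H (x, a) -> H (x, b) -> a = b.
  have le a' b' : H (x, a') -> H (x, b') -> a' <= b'.
    move=> xa xb; have := Hq _ _ (HD _ _ _ _ (-1) xa xb).
    by rewrite sofRN sofR1 scaleN1r subrr mulN1r (semi0 qs) subr_le0.
  by move=> xa xb; apply/eqP; rewrite eq_le !le.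
exists u; split.
- by move=> x y t; exact: uniq (uH _) (HD _ _ _ _ t (uH x) (uH y)).
- by move=> x; exact: Hq (uH x).
- by move=> x a xa; apply: uniq (uH x) _; right.
Qed.

(** The subspace is presented as the image of a linear map, so that lines [t *: x] and graphs
    [(x, c0_val x)] can be used directly. Injectivity of [L] is replaced by the domination, which
    makes [f] constant on the fibres of [L]. *)
Lemma hahn_banach (D : lmodType (scalars R k)) (L : D -> V) (f : D -> sline R k) :
  linear L -> linear f -> (forall x, nrm (f x) <= q (L x)) ->
  exists g : V -> sline R k,
    [/\ linear g, forall x, nrm (g x) <= q x & forall x, g (L x) = f x].
Proof.
move=> linL linf fq.
pose G0 := [set p : V * R | exists x, p = (L x, sre (f x))].
have [|u [ulin uq uG]] := @real_hahn_banach G0.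
  split.
  - exists 0; rewrite (linear_fun_0 linL) (linear_fun_0 linf); congr (_, _).
    by apply: (@sofR_inj R k); rewrite sreK// sofR0.
  - move=> _ _ _ _ t [x [-> ->]] [y [-> ->]].
    exists (sofR t *: y + x); congr (_, _); first by rewrite linL addrC.
    by rewrite linf sreD addrC; congr (_ + _); rewrite -sre_sofRM.
  - by move=> _ _ [x [-> ->]]; rewrite (le_trans (sre_le_sabs _))//; exact: fq.
have uL x : u (L x) = sre (f x) by apply: uG; exists x.
have uD x y : u (x + y) = u x + u y by have := ulin x y 1; rewrite sofR1 scale1r mul1r.
have u0 : u 0 = 0 by apply: (@addrI _ (u 0)); rewrite -uD !addr0.
have uZ t x : u (sofR t *: x) = t * u x by have := ulin 0 x t; rewrite u0 !add0r.
have [g ling gu] := exists_functional_of_re ulin.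
exists g; split=> //.
  move=> x; have [t t1 tg] := exists_phase (g x).
  have -> : nrm (g x) = sre (g (t *: x)).
    by rewrite (linear_fun_Z ling) [_ *: _]tg sofRK.
  by rewrite gu (le_trans (uq _))// qs.2 t1 mul1r.
move=> x; apply: (@functional_eq_re _ _ _ (g \o L) f) => // [a y z|y] /=.
  by rewrite linL ling.
by rewrite gu.
Qed.

End HahnBanach.

(** * Bounded operators and totally bounded sets *)

Section BoundedOperatorNorms.
Context {R : realType} {k : scalar_kind}.
Implicit Types X Y Z : Banach R k.

Lemma bop_eq X Y (S T : bop X Y) : S =1 T -> S = T.
Proof. by move=> /funext ST; exact/val_inj. Qed.

Lemma bopB X Y (T : bop X Y) x y : T (x - y) = T x - T y.
Proof. exact: (linear_fun_B (bop_linear T)). Qed.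

Lemma bopD X Y (T : bop X Y) x y : T (x + y) = T x + T y.
Proof. exact: (linear_fun_D (bop_linear T)). Qed.

Lemma bopZ X Y (T : bop X Y) a x : T (a *: x) = a *: T x.
Proof. exact: (linear_fun_Z (bop_linear T)). Qed.

Lemma bop0 X Y (T : bop X Y) : T 0 = 0.
Proof. exact: (linear_fun_0 (bop_linear T)). Qed.

Lemma nrm_bop X Y (T : bop X Y) : nrm T = opnorm T.
Proof. by rewrite /nrm bop_normE sofRK. Qed.

Lemma ler_nrm_bop X Y (T : bop X Y) x : nrm (T x) <= opnorm T * nrm x.
Proof. by rewrite -(@ler_sofR R k) sofRM !sofR_nrm ler_opnorm. Qed.

Lemma opnorm_ler_ball X Y (T : bop X Y) (c : R) :
  (forall x, nrm x <= 1 -> nrm (T x) <= c) -> opnorm T <= c.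
Proof.
move=> Tc; rewrite -(@ler_sofR R k); apply: opnorm_le => x x1.
by rewrite -sofR_nrm ler_sofR; apply: Tc; apply/unit_ballE.
Qed.

Lemma opnorm_ler X Y (T : bop X Y) (c : R) : 0 <= c ->
  (forall x, nrm (T x) <= c * nrm x) -> opnorm T <= c.
Proof.
move=> c0 Tc; apply: opnorm_ler_ball => x x1.
by rewrite (le_trans (Tc x))// ler_piMr.
Qed.

Lemma exists_bop X Y (f : X -> Y) (c : R) : 0 <= c -> linear f ->
  (forall x, nrm (f x) <= c * nrm x) -> exists2 T : bop X Y, T =1 f & opnorm T <= c.
Proof.
move=> c0 linf fc.
have fm : f \in bounded_operator X Y.
  apply: (@bop_of_bound_subproof _ _ X Y f (sofR c)) => //.
    by rewrite -(@sofR0 R k) ler_sofR.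
  by move=> x; rewrite -!sofR_nrm -sofRM ler_sofR.
by exists (Bop fm) => //; exact: opnorm_ler.
Qed.

Lemma opnorm_comp X Y Z (U : bop Y Z) (V : bop X Y) :
  opnorm (bcomp U V) <= opnorm U * opnorm V.
Proof.
apply: opnorm_ler; first by rewrite mulr_ge0 ?opnorm_ge0.
move=> x; rewrite (le_trans (ler_nrm_bop U (V x)))// -mulrA.
by rewrite ler_wpM2l ?opnorm_ge0// ler_nrm_bop.
Qed.

Lemma opnormZ X Y a (T : bop X Y) : opnorm (a *: T) = sabs a * opnorm T.
Proof. by rewrite -!nrm_bop nrmZ. Qed.

Lemma opnormD X Y (S T : bop X Y) : opnorm (S + T) <= opnorm S + opnorm T.
Proof. by rewrite -!nrm_bop ler_nrmD. Qed.

Lemma opnormN X Y (T : bop X Y) : opnorm (- T) = opnorm T.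
Proof. by rewrite -!nrm_bop nrmN. Qed.

Lemma opnorm_id X : opnorm (bid X) <= 1.
Proof. by apply: opnorm_ler => // x; rewrite mul1r. Qed.

Lemma opnorm_adjoint X Y (T : bop X Y) : opnorm (adjoint T) <= opnorm T.
Proof.
apply: opnorm_ler => [|f]; first exact: opnorm_ge0.
by rewrite !nrm_bop (le_trans (opnorm_comp _ _))// mulrC.
Qed.

Lemma ler_functional X (f : dual X) x : sabs (f x) <= nrm f * nrm x.
Proof. by rewrite sabs_nrm nrm_bop ler_nrm_bop. Qed.

Lemma kappaE X (x : X) (f : dual X) : kappa X x f = f x. Proof. by []. Qed.

Lemma adjointE X Y (T : bop X Y) (f : dual Y) x : adjoint T f x = f (T x).
Proof. by []. Qed.

Lemma opnorm_kappa X : opnorm (kappa X) <= 1.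
Proof.
apply: opnorm_ler => // x; rewrite mul1r nrm_bop; apply: opnorm_ler.
  exact: nrm_ge0.
by move=> f; rewrite kappaE nrm_bop mulrC ler_nrm_bop.
Qed.

Lemma exists_norming X (x : X) :
  exists2 f : dual X, nrm f <= 1 & f x = sofR (nrm x).
Proof.
have qs : seminorm (@nrm R k X) by split; [exact: ler_nrmD|exact: nrmZ].
have [||t|g [ling gq gx]] := @hahn_banach _ _ _ _ qs (scalars R k)^o
    (fun t => t *: x) (fun t => t * sofR (nrm x)).
- by move=> a s t; rewrite scalerDl scalerA.
- by move=> a s t; rewrite mulrDl -mulrA.
- rewrite [leLHS]nrmZ [leRHS]nrmZ nrm_sline.
  by rewrite sabs_sofR ger0_norm ?nrm_ge0.
have [|f fg f1] := @exists_bop X (sline R k) g 1 ler01 ling.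
  by move=> y; rewrite mul1r.
exists f; first by rewrite nrm_bop.
by rewrite fg -[x in LHS]scale1r gx mul1r.
Qed.

Lemma nrm_kappa X (x : X) : nrm (kappa X x) = nrm x.
Proof.
apply/eqP; rewrite eq_le; apply/andP; split.
  rewrite (le_trans (ler_nrm_bop _ _))// ler_piMl ?nrm_ge0//.
  exact: opnorm_kappa.
have [f f1 fx] := exists_norming x.
have := ler_functional (kappa X x) f.
rewrite kappaE fx sabs_sofR ger0_norm ?nrm_ge0// => /le_trans; apply.
by rewrite ler_piMr ?nrm_ge0.
Qed.

Lemma kappa_inj X : injective (kappa X).
Proof.
move=> x y xy; apply/eqP; rewrite -subr_eq0 -nrm_eq0 -nrm_kappa bopB.
by rewrite xy subrr nrm0.
Qed.

End BoundedOperatorNorms.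

(** * Total boundedness, compactness and limits in terms of the real-valued norm *)

Section MetricTopology.
Context {R : realType} {k : scalar_kind}.
Implicit Types X Y : Banach R k.

Lemma ball_nrm (X : normedModType (scalars R k)) (x : X) (e : R) y : ball x (sofR e) y <-> nrm (x - y) < e.
Proof. by rewrite -ball_normE/= -(@ltr_sofR R k) sofR_nrm. Qed.

Lemma sofR_gt0 (e : R) : (0 < (sofR e : scalars R k)) = (0 < e).
Proof. by rewrite -(@sofR0 R k) ltr_sofR. Qed.

Lemma gt0_sofR (e : scalars R k) : 0 < e -> exists2 d : R, 0 < d & e = sofR d.
Proof.
by move=> e0; exists (sre e); rewrite ?sreK ?ltW// -sofR_gt0 sreK ?ltW.
Qed.

Lemma nbhs_nrm (X : normedModType (scalars R k)) (x : X) A :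
  nbhs x A <-> exists2 e : R, 0 < e & forall y, nrm (x - y) < e -> A y.
Proof.
split=> [/nbhs_ballP[_/posnumP[e] eA]|[e e0 eA]].
  have [d d0 ed] := gt0_sofR (gt0 e).
  by exists d => // y /ball_nrm xy; apply: eA => /=; rewrite ed.
apply/nbhs_ballP; exists (sofR e); rewrite /= ?sofR_gt0//.
by move=> y /ball_nrm; exact: eA.
Qed.

Lemma closure_nrm X (S : set X) x :
  closure S x <-> forall e : R, 0 < e -> exists2 y, S y & nrm (x - y) < e.
Proof.
split=> [Sx e e0|Sx B /nbhs_nrm[e /Sx[y Sy xy] eB]].
  have [|y [Sy xy]] := Sx [set y | nrm (x - y) < e]; last by exists y.
  by apply/nbhs_nrm; exists e.
by exists y; split => //; exact: eB.
Qed.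

(** The centres need not lie in [S], so a net of a set is also a net of each of its subsets. *)
Definition totally_bounded X (S : set X) := forall e : R, 0 < e ->
  exists s : seq X, forall x, S x -> exists2 y, y \in s & nrm (x - y) < e.

Lemma totally_boundedS X (S T : set X) :
  S `<=` T -> totally_bounded T -> totally_bounded S.
Proof.
by move=> ST Tt e e0; have [s Ts] := Tt e e0; exists s => x /ST/Ts.
Qed.

Lemma totally_bounded_closure X (S : set X) :
  totally_bounded S -> totally_bounded (closure S).
Proof.
move=> St e e0; have e2 : 0 < e / 2 by rewrite divr_gt0.
have [s Ss] := St _ e2; exists s => x /closure_nrm/(_ _ e2)[y /Ss[z zs yz] xy].
exists z => //; rewrite [e]splitr.
by rewrite (le_lt_trans (nrm_triangle y _ _))// ltrD.
Qed.

Lemma compact_totally_bounded X (S : set X) : compact S -> totally_bounded S.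
Proof.
rewrite compact_cover => Sc e e0.
have [||D _ SD] := Sc X S (fun y => [set x | nrm (y - x) < e]).
- move=> y _; rewrite openE => x /= yx; apply/nbhs_nrm.
  exists (e - nrm (y - x)); rewrite ?subr_gt0// => z xz /=.
  by rewrite (le_lt_trans (nrm_triangle x _ _))// -ltrBrDl.
- by move=> x Sx; exists x => //=; rewrite subrr nrm0.
exists (finmap.enum_fset D) => x /SD[y yD /= yx].
by exists y => //; rewrite nrmBC.
Qed.

(** An ultrafilter on the closure contains one of the finitely many balls of a covering; otherwise
    it would contain all their complements, hence the empty set. It is therefore Cauchy and
    converges by completeness. *)
Lemma totally_bounded_precompact X (S : set X) :
  totally_bounded S -> precompact S.
Proof.
move=> /totally_bounded_closure St; have Scl := @closed_closure _ S.
rewrite precompactE compact_ultra => F FU FS.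
have Fc : cauchy F.
  apply/cauchyP => _ /gt0_sofR[e e0 ->].
  have [s Ss] := St e e0.
  have [y ys Fy] : exists2 y, y \in s & F (ball y (sofR e)).
    apply: contrapT => nF.
    suff: F set0 by exact: filter_not_empty.
    have : F (closure S `&` [set x | forall y, y \in s -> ~ ball y (sofR e) x]).
      apply: filterI => //; elim: {Ss} s nF => [|y s IH] nF.
        by apply: filterS filterT => x _ y.
      have Fy : F (~` ball y (sofR e)).
        have [Fy|//] := in_ultra_setVsetC (ball y (sofR e)) FU.
        by exfalso; apply: nF; exists y; rewrite ?mem_head.
      have IHs : F [set x | forall y, y \in s -> ~ ball y (sofR e) x].
        by apply: IH => -[z zs Fz]; apply: nF; exists z; rewrite ?inE ?zs ?orbT.
      apply: filterS (filterI Fy IHs) => x [xy xs] z; rewrite inE.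
      by case/orP => [/eqP ->|/xs].
    apply: filterS => x [/Ss[y ys xy] /(_ y ys)]; apply.
    by apply/ball_nrm; rewrite nrmBC.
  by exists y.
have Fp : cvg F by apply: cauchy_cvg.
exists (lim F); split=> //; rewrite ((closure_id (closure S)).1 Scl) => B /Fp FB.
exact: filter_ex (filterI FS FB).
Qed.

Lemma precompactP X (S : set X) : precompact S <-> totally_bounded S.
Proof.
split; last exact: totally_bounded_precompact.
rewrite precompactE => /compact_totally_bounded; apply: totally_boundedS.
exact: subset_closure.
Qed.

Lemma totally_bounded_image X Y (T : bop X Y) (S : set X) :
  totally_bounded S -> totally_bounded (T @` S).
Proof.
move=> St e e0.
have c0 : 0 < opnorm T + 1 by rewrite ltr_wpDl ?opnorm_ge0.
have [s Ss] := St (e / (opnorm T + 1)) (divr_gt0 e0 c0).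
exists (map T s) => _ [x /Ss[y ys xy] <-]; exists (T y); first exact: map_f.
rewrite -bopB (le_lt_trans (ler_nrm_bop _ _))//.
rewrite (@le_lt_trans _ _ ((opnorm T + 1) * nrm (x - y)))//.
  by rewrite ler_wpM2r ?nrm_ge0// lerDl.
by rewrite mulrC -ltr_pdivlMr.
Qed.

Lemma totally_boundedD X (S T : set X) : totally_bounded S -> totally_bounded T ->
  totally_bounded [set x + y | x in S & y in T].
Proof.
move=> St Tt e e0; have e2 : 0 < e / 2 by rewrite divr_gt0.
have [s Ss] := St _ e2; have [t Tts] := Tt _ e2.
exists [seq x + y | x <- s, y <- t] => _ [x /Ss[x' xs xx] [y /Tts[y' yt yy] <-]].
exists (x' + y'); first by apply/allpairsP; exists (x', y').
rewrite opprD addrACA (le_lt_trans (ler_nrmD _ _))// [e]splitr ltrD//.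
Qed.

Definition sim : scalars R k -> R :=
  match k return scalars R k -> R with
  | RealScalars => fun=> 0 | ComplexScalars => @complex.Im R
  end.

Lemma simB a b : sim (a - b) = sim a - sim b.
Proof. by rewrite /sim; case: k a b => [a b|[? ?] [? ?]]; rewrite ?subrr. Qed.

Lemma sreB (a b : scalars R k) : sre (a - b) = sre a - sre b.
Proof. by rewrite /sre; case: k a b => [a b|[? ?] [? ?]]. Qed.

Lemma sre_sim_bound (a : scalars R k) :
  [/\ `|sre a| <= sabs a, `|sim a| <= sabs a & sabs a <= `|sre a| + `|sim a|].
Proof.
rewrite /sabs /sre /sim; case: k a => [a|[a b]] /=.
  by rewrite normr0 addr0.
split.
- by rewrite -sqrtr_sqr ler_wsqrtr// lerDl sqr_ge0.
- by rewrite -sqrtr_sqr ler_wsqrtr// lerDr sqr_ge0.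
- rewrite -[leRHS]ger0_norm ?addr_ge0// -sqrtr_sqr ler_wsqrtr// sqrrD.
  by rewrite !real_normK ?num_real// -addrA lerD2l lerDr mulrn_wge0// mulr_ge0.
Qed.

(** Round the real and imaginary parts of the coordinates to a grid of mesh [d / 2]. Boundedness
    leaves finitely many cells, and points of [S] in the same cell have coordinates closer than [d].
    One point of [S] per occupied cell gives the net; an empty cell is assigned 0. *)
Lemma totally_bounded_coord X (S : set X) :
  (forall e : R, 0 < e -> exists (I : finType) (h : X -> I -> scalars R k) (M d : R),
    [/\ 0 < d, forall x i, S x -> sabs (h x i) <= M &
      forall x y, S x -> S y -> (forall i, sabs (h x i - h y i) < d) ->
        nrm (x - y) < e]) ->
  totally_bounded S.
Proof.
move=> Sh e /Sh[I [h [M [d [d0 hM hd]]]]].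
pose r x (j : I * bool) := if j.2 then sre (h x j.1) else sim (h x j.1).
have d2 : 0 < d / 2 by rewrite divr_gt0.
pose cell x j := Num.truncn ((r x j + M) / (d / 2)).
pose B := Num.truncn ((M + M) / (d / 2)).
have rM x j : S x -> `|r x j| <= M.
  move=> Sx; have [re im _] := sre_sim_bound (h x j.1).
  by rewrite /r; case: ifP => _; rewrite (le_trans _ (hM _ j.1 Sx)).
have cell_pos x j : S x -> 0 <= (r x j + M) / (d / 2).
  move=> Sx; rewrite divr_ge0 ?(ltW d2)// -lerBlDr sub0r.
  by have := rM x j Sx; rewrite ler_norml => /andP[].
have cellB x j : S x -> (cell x j < B.+1)%N.
  move=> Sx; rewrite ltnS; apply: le_truncn.
  rewrite ler_pM2r ?invr_gt0// lerD2r.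
  by have := rM x j Sx; rewrite ler_norml => /andP[].
pose c x : {ffun I * bool -> 'I_B.+1} := [ffun j => inord (cell x j)].
have /choice[rep repP] (f : {ffun I * bool -> 'I_B.+1}) :
    exists y, forall x, S x -> c x = f -> S y /\ c y = f.
  have [[x Sx cx]|nx] := pselect (exists2 x, S x & c x = f); first by exists x.
  by exists 0 => x Sx cx; case: nx; exists x.
exists (codom rep) => x Sx; exists (rep (c x)); first exact: codom_f.
have [Sy cy] := repP _ _ Sx erefl.
apply: hd => // i.
have close b : `|r x (i, b) - r (rep (c x)) (i, b)| < d / 2.
  set y := rep _ in Sy cy *; set j := (i, b).
  have xy : cell x j = cell y j.
    have := congr1 (fun f : {ffun _ -> 'I_B.+1} => val (f j)) cy.
    by rewrite !ffunE /= !inordK ?cellB.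
  have := truncn_itv (cell_pos x j Sx); have := truncn_itv (cell_pos y j Sy).
  rewrite -/(cell x j) -/(cell y j) xy.
  rewrite !ler_pdivlMr// !ltr_pdivrMr// => /andP[y1 y2] /andP[x1 x2].
  rewrite -natr1 mulrDl mul1r in y2 x2.
  by rewrite ltr_norml; apply/andP; split; lra.
have [_ _] := sre_sim_bound (h x i - h (rep (c x)) i).
rewrite sreB simB => /le_lt_trans; apply.
by rewrite [d]splitr ltrD//; [exact: (close true)|exact: (close false)].
Qed.

Lemma compact_opP X Y (T : bop X Y) :
  compact_op X Y T <-> totally_bounded (T @` unit_ball X).
Proof. exact: precompactP. Qed.

Lemma exists_limit X (u : nat -> X) :
  (forall e : R, 0 < e -> exists N, forall n m, (N <= n)%N -> (N <= m)%N ->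
    nrm (u n - u m) < e) ->
  exists l, forall e : R, 0 < e -> exists N, forall n, (N <= n)%N -> nrm (l - u n) < e.
Proof.
move=> uc.
have uF : cauchy (u @ \oo).
  apply/cauchyP => _ /gt0_sofR[e /uc[N uN] ->]; exists (u N).
  by exists N => // n /= Nn; apply/ball_nrm; exact: uN.
have ul : cvg (u @ \oo) by apply: cauchy_cvg.
set l := lim _ in ul; exists l => e e0.
have /ul[N _ uN] : nbhs l [set y | nrm (l - y) < e] by apply/nbhs_nrm; exists e.
by exists N => n Nn; exact: uN.
Qed.

Lemma isometry_closed X Y (T : bop X Y) z : (forall x, nrm (T x) = nrm x) ->
  (forall e : R, 0 < e -> exists x, nrm (z - T x) < e) -> exists x, T x = z.
Proof.
move=> Tiso Tz.
have e_gt0 n : 0 < n.+1%:R^-1 :> R by rewrite invr_gt0.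
have small (e : R) : 0 < e -> exists N, forall n, (N <= n)%N -> n.+1%:R^-1 < e.
  move=> e0; exists (Num.truncn e^-1) => n Nn.
  rewrite invf_plt ?posrE// (lt_le_trans (truncnS_gt _))// ler_nat ltnS//.
have [u uz] := choice (fun n => Tz _ (e_gt0 n)).
have [e e0|l ul] := @exists_limit X u.
  have [N NP] := small (e / 2) (divr_gt0 e0 (ltr0n _ 2)).
  exists N => n m Nn Nm; rewrite -Tiso bopB [e]splitr.
  rewrite (le_lt_trans (nrm_triangle z _ _))// ltrD//.
    by rewrite nrmBC (lt_trans (uz n))// NP.
  by rewrite (lt_trans (uz m))// NP.
exists l; apply/eqP; rewrite -subr_eq0 -nrm_eq0 eq_le nrm_ge0 andbT.
apply/ler_addgt0Pr => e e0; rewrite add0r.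
have e2 : 0 < e / 2 by rewrite divr_gt0.
have [N NP] := small _ e2; have [M MP] := ul _ e2.
rewrite (le_trans (nrm_triangle (T (u (maxn N M))) _ _))// [e]splitr lerD//.
  by rewrite -bopB Tiso ltW// MP// leq_maxr.
by rewrite nrmBC (ltW (lt_trans (uz _) _))// NP// leq_maxl.
Qed.

End MetricTopology.

(** * Goldstine's and Schauder's theorems *)

Lemma telescope3 (V : zmodType) (a b c d : V) :
  a - d = (a - b) + (b - c) - (d - c).
Proof. by rewrite opprB !addrA !addrNK. Qed.

(** * Quotient seminorms *)

Section InfSeminorm.
Context {R : realType} {k : scalar_kind} (U V : lmodType (scalars R k)).
Context (N : U -> V -> R).
Hypothesis ND : forall x y v w, N (x + y) (v + w) <= N x v + N y w.
Hypothesis NZ : forall a x v, N (a *: x) (a *: v) = sabs a * N x v.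

(** The quotient modulo U of a joint seminorm on the product of U and V. It expresses a best
    approximation: by points of a space in Helly's lemma, by coefficient vectors in the construction
    of admissible spaces. *)
Definition inf_semi (v : V) : R := inf [set N x v | x in [set: U]].

Lemma inf_semi_arg_ge0 x v : 0 <= N x v.
Proof.
have N00 : N 0 0 = 0 by rewrite -(scale0r (0 : U)) -(scale0r (0 : V)) NZ sabs0 mul0r.
have := ND x (-1 *: x) v (-1 *: v); rewrite NZ sabsN sabs1 mul1r !scaleN1r !subrr.
by rewrite N00 -mulr2n pmulrn_lge0.
Qed.

Lemma inf_semi_le x v : inf_semi v <= N x v.
Proof. by apply: ge_inf; [exists 0 => _ [y _ <-]; exact: inf_semi_arg_ge0|exists x]. Qed.

Lemma inf_semi_ge v c : (forall x, c <= N x v) -> c <= inf_semi v.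
Proof.
by move=> cN; apply: lb_le_inf; [exists (N 0 v), 0|move=> _ [x _ <-]].
Qed.

Lemma inf_semi_lt v c : inf_semi v < c -> exists x, N x v < c.
Proof.
move=> vc; apply: contrapT => nx; move: vc; apply/negP; rewrite -leNgt.
by apply: inf_semi_ge => x; rewrite leNgt; apply/negP => xc; apply: nx; exists x.
Qed.

Lemma seminorm_inf : seminorm inf_semi.
Proof.
split=> [v w|a v].
  apply/ler_addgt0Pr => e e0.
  have e2 : 0 < e / 2 by rewrite divr_gt0.
  have [x xv] : exists x, N x v < inf_semi v + e / 2 by apply: inf_semi_lt; rewrite ltrDl.
  have [y yw] : exists y, N y w < inf_semi w + e / 2 by apply: inf_semi_lt; rewrite ltrDl.
  rewrite (le_trans (inf_semi_le (x + y) _))// (le_trans (ND _ _ _ _))//.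
  by rewrite (le_trans (lerD (ltW xv) (ltW yw)))// addrACA -splitr.
have le b w : inf_semi (b *: w) <= sabs b * inf_semi w.
  have [->|b0] := eqVneq b 0.
    by rewrite scale0r sabs0 mul0r (le_trans (inf_semi_le 0 _))//
       -(scale0r (0 : U)) -(scale0r (0 : V)) NZ sabs0 mul0r.
  have b_gt0 : 0 < sabs b by rewrite lt_def sabs_eq0 b0 sabs_ge0.
  rewrite mulrC -ler_pdivrMr//; apply: inf_semi_ge => x.
  by rewrite ler_pdivrMr// mulrC -NZ inf_semi_le.
apply/eqP; rewrite eq_le le/=.
have [->|a0] := eqVneq a 0.
  by rewrite sabs0 mul0r; apply: inf_semi_ge => x; exact: inf_semi_arg_ge0.
have a_gt0 : 0 < sabs a by rewrite lt_def sabs_eq0 a0 sabs_ge0.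
have := le a^-1 (a *: v); rewrite scalerA mulVf// scale1r sabsV.
by rewrite ler_pdivlMl.
Qed.

End InfSeminorm.

(** * Helly's lemma, liftings through injective operators, and adjoints of compact operators *)

Section Duality.
Context {R : realType} {k : scalar_kind}.
Implicit Types X Y Z E F G : Banach R k.

Lemma bop_sumE X Y n (F : 'I_n -> bop X Y) x : (\sum_i F i) x = \sum_i F i x.
Proof. by elim/big_ind2: _ => // S s T t <- <-. Qed.

(* If the best value of [nrm x + M * sum |f i x - w (f i)|]
   exceeded [nrm w], a functional norming the corresponding seminorm on [k^n]
   would be a combination of the [f i] of norm at most [1] violating
   [|w f| <= nrm w * nrm f]. *)
Lemma helly X n (f : 'I_n -> dual X) (w : dual (dual X)) (e : R) : 0 < e ->
  exists2 x : X, nrm x <= nrm w + 1 & forall i, sabs (w (f i) - f i x) <= e.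
Proof.
move=> e0; pose M := (nrm w + 1) / e.
have M0 : 0 < M by rewrite divr_gt0// ltr_wpDl ?nrm_ge0.
pose V := 'I_n -> sline R k.
pose N (x : X) (v : V) := nrm x + M * \sum_i nrm (v i - f i x : sline R k).
have ND x y (v u : V) : N (x + y) (v + u) <= N x v + N y u.
  rewrite /N addrACA -mulrDr lerD ?ler_nrmD// ler_wpM2l ?(ltW M0)//.
  rewrite -big_split/=; apply: ler_sum => i _.
  by rewrite bopD opprD addrACA ler_nrmD.
have NZ a x (v : V) : N (a *: x) (a *: v) = sabs a * N x v.
  rewrite /N nrmZ mulrDr; congr (_ + _); rewrite mulrCA; congr (_ * _).
  rewrite mulr_sumr; apply: eq_bigr => i _.
  by rewrite -nrmZ scalerBr bopZ.
have qs := seminorm_inf ND NZ.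
pose v : V := fun i => w (f i).
have [||t|a [lina aq av]] := @hahn_banach _ _ _ _ qs (scalars R k)^o
    (fun t => t *: v) (fun t => t * sofR (inf_semi N v)).
- by move=> a s t; rewrite scalerDl scalerA.
- by move=> a s t; rewrite mulrDl -mulrA.
- rewrite [leLHS]nrmZ qs.2 nrm_sline sabs_sofR ger0_norm// semi_ge0//.
pose d i : V := fun j => (i == j)%:R.
have uE (u : V) : u = \sum_i u i *: d i.
  apply/funext => j; rewrite fct_sumE (bigD1 j)//= big1.
    by rewrite addr0 -[LHS]mulr1 /d -[RHS]/(u j * (j == j)%:R) eqxx.
  by move=> i /negPf ij; rewrite -[LHS]/(u i * (i == j)%:R) ij mulr0.
have aE (u : V) : a u = \sum_i u i *: a (d i).
  rewrite [u in LHS]uE; elim/big_rec2: _ => [|i y x _ <-]; first exact: linear_fun_0.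
  by rewrite (linear_fun_D lina) (linear_fun_Z lina).
pose g : dual X := \sum_i a (d i) *: f i.
have g1 : nrm g <= 1.
  rewrite nrm_bop; apply: opnorm_ler => // x; rewrite mul1r bop_sumE.
  have -> : \sum_i (a (d i) *: f i) x = a (fun i => f i x).
    by rewrite aE; apply: eq_bigr => i _; exact: mulrC.
  rewrite (le_trans (aq _))// (le_trans (inf_semi_le ND NZ x _))// /N.
  by rewrite big1 ?mulr0 ?addr0// => i _; rewrite subrr nrm0.
have qw : inf_semi N v <= nrm w.
  have : a v = w g.
    rewrite aE /g; elim/big_ind2: _ => [|x y z t -> ->|i _]; first by rewrite bop0.
      by rewrite bopD.
    by rewrite bopZ; exact: mulrC.
  have := av 1; rewrite scale1r mul1r => -> wg.
  have := ler_functional w g; rewrite -wg sabs_sofR.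
  rewrite ger0_norm ?semi_ge0// => /le_trans; apply.
  by rewrite ler_piMr ?nrm_ge0.
have [|x xv] := @inf_semi_lt _ _ _ _ N v (nrm w + 1).
  by rewrite (le_lt_trans qw)// ltrDl.
have S0 : 0 <= \sum_i nrm (v i - f i x : sline R k).
  by rewrite sumr_ge0// => i _; exact: nrm_ge0.
exists x => [|i].
  by rewrite (le_trans _ (ltW xv))// lerDl mulr_ge0// ltW.
have : M * sabs (w (f i) - f i x) <= M * e.
  rewrite [M * e]divfK ?gt_eqF// (le_trans _ (ltW xv))// /N.
  rewrite (@le_trans _ _ (M * \sum_i nrm (v i - f i x : sline R k)))//.
    rewrite ler_wpM2l ?(ltW M0)// (bigD1 i)//= lerDl.
    by rewrite sumr_ge0// => j _; exact: nrm_ge0.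
  by rewrite lerDr nrm_ge0.
by rewrite ler_pM2l.
Qed.

(** Helly's lemma is applied on a finite net of [C] with error [e / 2]. Both [w] and [x] have norm
    at most [nrm w + 1], so passing from a point of [C] to the net costs each of them at most
    [e / 4]. *)
Lemma goldstine X (C : set (dual X)) (w : dual (dual X)) (e : R) :
  totally_bounded C -> 0 < e ->
  exists2 x : X, nrm x <= nrm w + 1 & forall f, C f -> sabs (w f - f x) <= e.
Proof.
move=> Ct e0; have w0 : 0 < nrm w + 1 by rewrite ltr_wpDl ?nrm_ge0.
have d0 : 0 < e / 4 / (nrm w + 1) by rewrite !divr_gt0.
have [s Cs] := Ct _ d0.
have [x xw xs] := helly (fun i => tnth (in_tuple s) i) w (divr_gt0 e0 (ltr0n _ 2)).
exists x => // f /Cs[g gs fg].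
have {xs} := xs (Ordinal (ltac:(by rewrite index_mem) : (index g s < size s)%N)).
rewrite (tnth_nth 0)/= nth_index// => gx.
have -> : w f - f x = w (f - g) + (w g - g x) - (f - g) x.
  have -> : (f - g) x = f x - g x by [].
  by rewrite bopB; exact: telescope3.
have h1 : sabs (w (f - g)) <= e / 4.
  rewrite (le_trans (ler_functional _ _))//.
  rewrite (@le_trans _ _ ((nrm w + 1) * nrm (f - g)))//.
    by rewrite ler_wpM2r ?nrm_ge0// lerDl.
  by rewrite mulrC -ler_pdivlMr// ltW.
have h2 : sabs ((f - g) x) <= e / 4.
  rewrite (le_trans (ler_functional _ _))//.
  rewrite (@le_trans _ _ (nrm (f - g) * (nrm w + 1)))//.
    by rewrite ler_wpM2l ?nrm_ge0.
  by rewrite -ler_pdivlMr// ltW.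
rewrite sabs_nrm (le_trans (ler_nrmB _ _))//.
rewrite (@le_trans _ _ (e / 4 + e / 2 + e / 4))//.
  by rewrite lerD// (le_trans (ler_nrmD _ _))// lerD.
lra.
Qed.

(** Injectivity of [i] makes the pointwise choice of preimages linear. *)
Lemma lift_injective E F G (i : bop F G) (B : bop E G) (c : R) : 0 <= c ->
  injective i -> (forall x, exists2 y, i y = B x & nrm y <= c * nrm x) ->
  exists2 J : bop E F, bcomp i J = B & opnorm J <= c.
Proof.
move=> c0 inj iB.
have /choice[j jP] x : exists y, i y = B x /\ nrm y <= c * nrm x.
  by have [y] := iB x; exists y.
have [a x y||J Jj Jc] := @exists_bop _ _ E F j c c0.
- by apply: inj; rewrite bopD bopZ !(jP _).1 bopD bopZ.
- by move=> x; exact: (jP x).2.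
by exists J => //; apply: bop_eq => x; rewrite /= Jj (jP x).1.
Qed.

Lemma lift_unit_ball E F G (i : bop F G) (B : bop E G) : injective i ->
  (forall x, nrm x <= 1 -> exists2 y, i y = B x & nrm y <= 1) ->
  exists2 J : bop E F, bcomp i J = B & opnorm J <= 1.
Proof.
move=> inj iB; apply: lift_injective => // x; rewrite mul1r.
have [->|x0] := eqVneq x 0; first by exists 0; rewrite !(bop0, nrm0).
have nx : 0 < nrm x by rewrite nrm_gt0.
have [|y yx y1] := iB (sofR (nrm x)^-1 *: x).
  by rewrite nrmZ sabs_sofR ger0_norm ?invr_ge0 ?nrm_ge0// mulVf ?gt_eqF.
exists (sofR (nrm x) *: y).
  by rewrite bopZ yx bopZ scalerA -sofRM mulfV ?gt_eqF// sofR1 scale1r.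
by rewrite nrmZ sabs_sofR ger0_norm ?nrm_ge0// ler_piMr ?nrm_ge0.
Qed.

Lemma lift_kappa E F (B : bop E (dual (dual F))) : (forall x, exists y, kappa F y = B x) ->
  exists2 J : bop E F, bcomp (kappa F) J = B & opnorm J <= opnorm B.
Proof.
move=> kB; apply: lift_injective; [exact: opnorm_ge0|exact: kappa_inj|].
by move=> x; have [y yx] := kB x; exists y; rewrite // -nrm_kappa yx ler_nrm_bop.
Qed.

Lemma kappa_closed F (z : dual (dual F)) :
  (forall e : R, 0 < e -> exists x, nrm (z - kappa F x) < e) -> exists x, kappa F x = z.
Proof. by apply: isometry_closed; exact: nrm_kappa. Qed.

Lemma compact_comp_l X Y Z (U : bop Y Z) (V : bop X Y) :
  compact_op X Y V -> compact_op X Z (bcomp U V).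
Proof.
move=> /compact_opP Vt; apply/compact_opP.
apply: totally_boundedS (totally_bounded_image U Vt) => _ [x x1 <-].
by exists (V x) => //; exists x.
Qed.

Lemma compact_comp_r X Y Z (U : bop Y Z) (V : bop X Y) :
  compact_op Y Z U -> compact_op X Z (bcomp U V).
Proof.
move=> /compact_opP Ut; apply/compact_opP.
pose c := opnorm V + 1.
have c0 : 0 < c by rewrite ltr_wpDl ?opnorm_ge0.
apply: totally_boundedS (totally_bounded_image (sofR c *: bid Z) Ut) => _ [x /unit_ballE x1 <-].
exists (U (sofR c^-1 *: V x)); last first.
  by rewrite bopZ -[LHS]/(sofR c *: (sofR c^-1 *: _)) scalerA -sofRM mulfV ?gt_eqF// sofR1 scale1r.
exists (sofR c^-1 *: V x) => //; apply/unit_ballE.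
rewrite nrmZ sabs_sofR ger0_norm ?invr_ge0 ?(ltW c0)// ler_pdivrMl// mulr1.
rewrite (le_trans (ler_nrm_bop _ _))// (@le_trans _ _ (opnorm V))//.
  by rewrite ler_piMr ?opnorm_ge0.
by rewrite lerDl.
Qed.

Lemma compactD X Y (S T : bop X Y) :
  compact_op X Y S -> compact_op X Y T -> compact_op X Y (S + T).
Proof.
move=> /compact_opP St /compact_opP Tt; apply/compact_opP.
apply: totally_boundedS (totally_boundedD St Tt) => _ [x x1 <-].
by exists (S x); [exists x|exists (T x) => //; exists x].
Qed.

(** Pull a net of the image back by choosing, for each centre near the image, a point of [S] mapped
    close to it. The hypothesis says that the inverse of [i] is uniformly continuous on the image of
    [S]; it holds for isometries, and for the inclusion of the constructed admissible space
    restricted to the preimage of [C]. *)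
Lemma totally_bounded_pullback X Y (i : bop X Y) (S : set X) :
  (forall e : R, 0 < e -> exists2 d : R, 0 < d &
     forall x y, S x -> S y -> nrm (i (x - y)) < d -> nrm (x - y) < e) ->
  totally_bounded (i @` S) -> totally_bounded S.
Proof.
move=> Sd iS e /Sd[d d0 de]; have d2 : 0 < d / 2 by rewrite divr_gt0.
have [s sP] := iS _ d2.
have /choice[r rP] z : exists x, forall y, S y -> nrm (i y - z) < d / 2 ->
    S x /\ nrm (i x - z) < d / 2.
  have [[x Sx xz]|nx] := pselect (exists2 x, S x & nrm (i x - z) < d / 2); first by exists x.
  by exists 0 => y Sy yz; case: nx; exists y.
exists (map r s) => x Sx; have [|z zs xz] := sP (i x); first by exists x.
exists (r z); first exact: map_f.
have [Sr rz] := rP _ _ Sx xz.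
apply: de => //; rewrite bopB [d]splitr (le_lt_trans (nrm_triangle z _ _))// ltrD//.
by rewrite nrmBC.
Qed.

Lemma compact_isometry X Y Z (i : bop Y Z) (T : bop X Y) :
  (forall x, nrm (i x) = nrm x) -> compact_op X Z (bcomp i T) -> compact_op X Y T.
Proof.
move=> iso /compact_opP iT; apply/compact_opP.
apply: (@totally_bounded_pullback _ _ i).
  by move=> e e0; exists e => // x y _ _; rewrite iso.
apply: totally_boundedS iT.
by move=> _ [_ [x x1 <-] <-]; exists x.
Qed.

(** The values of [f] on an [e / 4]-net of the image of the unit ball serve as coordinates of
    [adjoint T f]. Since [adjoint T f] does not determine [f], a preimage [r g] in the unit ball is
    fixed for each [g]. *)
Lemma schauder X Y (T : bop X Y) :
  compact_op X Y T -> compact_op (dual Y) (dual X) (adjoint T).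
Proof.
move=> /compact_opP Tt; apply/compact_opP; apply: totally_bounded_coord => e e0.
have e4 : 0 < e / 4 by rewrite divr_gt0.
have [s Ts] := Tt _ e4.
have /choice[r rP] (g : dual X) : exists f : dual Y,
    (adjoint T @` unit_ball (dual Y)) g -> nrm f <= 1 /\ adjoint T f = g.
  have [[f /unit_ballE f1 fg]|nf] := pselect ((adjoint T @` unit_ball (dual Y)) g).
    by exists f.
  by exists 0.
exists 'I_(size s), (fun g j => r g (tnth (in_tuple s) j)),
  (\sum_(j < size s) nrm (tnth (in_tuple s) j)), (e / 4); split=> //.
- move=> g j /rP[f1 _]; rewrite (le_trans (ler_functional _ _))//.
  rewrite (@le_trans _ _ (nrm (tnth (in_tuple s) j)))//.
    by rewrite ler_piMl ?nrm_ge0.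
  rewrite (bigD1 j)//= lerDl.
  by rewrite sumr_ge0// => i _; exact: nrm_ge0.
- move=> g h /rP[g1 gE] /rP[h1 hE] gh.
  rewrite nrm_bop (@le_lt_trans _ _ (e / 4 + e / 4 + e / 4))//; last by lra.
  apply: opnorm_ler_ball => x x1.
  have [|y ys xy] := Ts (T x); first by exists x => //; apply/unit_ballE.
  have {gh} := gh (Ordinal (ltac:(by rewrite index_mem) : (index y s < size s)%N)).
  rewrite (tnth_nth 0)/= nth_index// => gh.
  change (sabs (g x - h x) <= e / 4 + e / 4 + e / 4).
  have -> : g x - h x = r g (T x - y) + (r g y - r h y) - r h (T x - y).
    rewrite -[in LHS]gE -[in LHS]hE !adjointE !bopB.
    exact: telescope3.
  have small (f : dual Y) : nrm f <= 1 -> sabs (f (T x - y)) <= e / 4.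
    move=> f1; rewrite (le_trans (ler_functional _ _))//.
    rewrite (@le_trans _ _ (nrm (T x - y)))// ?(ltW xy)//.
    by rewrite ler_piMl ?nrm_ge0.
  rewrite (le_trans (ler_nrmB _ _))// lerD ?small//.
  by rewrite (le_trans (ler_nrmD _ _))// lerD ?small// ltW.
Qed.

(* By Goldstine and the compactness of [adjoint T], the values of the biadjoint
   are limits of points of [kappa F]. *)
Lemma bidual_compact E F (T : bop E F) : compact_op E F T ->
  exists2 J : bop (dual (dual E)) F,
    bcomp (kappa F) J = adjoint (adjoint T) & opnorm J <= opnorm T.
Proof.
move=> /schauder/compact_opP Tt.
have [w|J JT Jc] := @lift_kappa _ F (adjoint (adjoint T)).
  apply: kappa_closed => e e0; have e2 : 0 < e / 2 by rewrite divr_gt0.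
  have [x _ xw] := goldstine w Tt e2.
  exists (T x); rewrite (@le_lt_trans _ _ (e / 2))//; last by lra.
  rewrite nrm_bop; apply: opnorm_ler_ball => f f1.
  by apply: xw; exists f => //; apply/unit_ballE.
exists J => //; rewrite (le_trans Jc)// (le_trans (opnorm_adjoint _))//.
exact: opnorm_adjoint.
Qed.

End Duality.

(** * Admissible spaces *)

(** Each seminorm is continuous on [E], and the one of index 0 is equivalent to the norm. The latter
    makes the supremum of the sequence a norm for which the inclusion into [E] is bounded. *)
Record seminorm_seq (R : realType) k (E : Banach R k) := SeminormSeq {
  sn_fun :> nat -> E -> R;
  sn_semi : forall n, seminorm (sn_fun n);
  sn_bound : forall n, exists2 c : R, 0 < c & forall x, sn_fun n x <= c * nrm x;
  sn_lower : exists2 c : R, 0 < c & forall x, nrm x <= c * sn_fun 0%N x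
}.

(** * The subspace of [E] on which the seminorms tend to 0, normed by their supremum *)

Section C0Space.
Context {R : realType} {k : scalar_kind} {E : Banach R k} (p : seminorm_seq E).

Definition vanishing : {pred E} := [pred x | `[<
  forall e : R, 0 < e -> exists N, forall n, (N <= n)%N -> p n x <= e >]].

Lemma vanishing_submod : submod_closed vanishing.
Proof.
split=> [|a x y].
  by apply/asboolP => e e0; exists 0%N => n _; rewrite (semi0 (sn_semi p n)) ltW.
move=> /asboolP xc /asboolP yc; apply/asboolP => e e0.
have e2 : 0 < e / 2 by rewrite divr_gt0.
have a0 : 0 < sabs a + 1 by rewrite ltr_wpDl ?sabs_ge0.
have [N NP] := xc _ (divr_gt0 e2 a0); have [M MP] := yc _ e2.
exists (maxn N M) => n; rewrite geq_max => /andP[Nn Mn].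
rewrite (le_trans ((sn_semi p n).1 _ _))// [e]splitr lerD ?MP//.
rewrite (sn_semi p n).2 (@le_trans _ _ ((sabs a + 1) * p n x))//.
  by rewrite ler_wpM2r ?(semi_ge0 (sn_semi p n))// lerDl.
by rewrite mulrC -ler_pdivlMr// NP.
Qed.

Record c0_space := C0Space { c0_val :> E; c0_mem : c0_val \in vanishing }.

HB.instance Definition _ := [isSub of c0_space for c0_val].
HB.instance Definition _ := [Choice of c0_space by <:].
HB.instance Definition _ := GRing.isSubmodClosed.Build (scalars R k) E
  vanishing vanishing_submod.
HB.instance Definition _ := [SubChoice_isSubLmodule of c0_space by <:].

Definition c0_norm (x : c0_space) : R := sup [set p n (c0_val x) | n in [set: nat]].

Lemma seminorms_bound N : exists2 c : R, 0 < c &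
  forall n x, (n < N)%N -> p n x <= c * nrm x.
Proof.
elim: N => [|N [c c0 IH]]; first by exists 1.
have [d d0 dP] := sn_bound p N; exists (c + d) => [|n x]; first by rewrite addr_gt0.
rewrite ltnS leq_eqVlt => /predU1P[->|nN].
  by rewrite (le_trans (dP x))// ler_wpM2r ?nrm_ge0// lerDr ltW.
by rewrite (le_trans (IH _ _ nN))// ler_wpM2r ?nrm_ge0// lerDl ltW.
Qed.

Lemma c0_norm_ub (x : c0_space) n : p n (c0_val x) <= c0_norm x.
Proof.
apply: ub_le_sup; last by exists n.
have /asboolP/(_ 1 ltr01)[N NP] := c0_mem x; have [c c0 cP] := seminorms_bound N.
exists (c * nrm (c0_val x) + 1) => _ [m _ <-].
have [Nm|mN] := leqP N m.
  by rewrite (le_trans (NP _ Nm))// lerDr mulr_ge0 ?nrm_ge0// ltW.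
by rewrite (le_trans (cP _ _ mN))// lerDl.
Qed.

Lemma c0_norm_le (x : c0_space) c : (forall n, p n (c0_val x) <= c) -> c0_norm x <= c.
Proof.
by move=> xc; apply: ge_sup; [exists (p 0 (c0_val x)), 0%N|move=> _ [n _ <-]].
Qed.

Lemma c0_norm_ge0 x : 0 <= c0_norm x.
Proof. exact: le_trans (semi_ge0 (sn_semi p 0) _) (c0_norm_ub x 0). Qed.

Let norm (x : c0_space) : scalars R k := sofR (c0_norm x).

Lemma c0_normD_subproof (x y : c0_space) : norm (x + y) <= norm x + norm y.
Proof.
rewrite /norm -sofRD ler_sofR; apply: c0_norm_le => n.
by rewrite (le_trans ((sn_semi p n).1 _ _))// lerD// c0_norm_ub.
Qed.

Lemma c0_normZ_subproof l (x : c0_space) : norm (l *: x) = `|l| * norm x.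
Proof.
rewrite /norm -sofR_sabs -sofRM; congr sofR.
have le c y : c0_norm (c *: y) <= sabs c * c0_norm y.
  apply: c0_norm_le => n; rewrite (sn_semi p n).2.
  by rewrite ler_wpM2l ?sabs_ge0// c0_norm_ub.
apply/eqP; rewrite eq_le le/=.
have [->|l0] := eqVneq l 0; first by rewrite sabs0 mul0r c0_norm_ge0.
have := le l^-1 (l *: x); rewrite scalerA mulVf// scale1r sabsV.
by rewrite ler_pdivlMl// lt_def sabs_eq0 l0 sabs_ge0.
Qed.

Lemma c0_val_bound : exists2 c : R, 0 < c & forall x, nrm (c0_val x) <= c * c0_norm x.
Proof.
have [c c0 cP] := sn_lower p; exists c => // x.
by rewrite (le_trans (cP _))// ler_wpM2l ?(ltW c0)// c0_norm_ub.
Qed.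

Lemma c0_norm_eq0_subproof (x : c0_space) : norm x = 0 -> x = 0.
Proof.
rewrite /norm -(@sofR0 R k) => /sofR_inj x0; apply/val_inj => /=.
apply/eqP; rewrite -nrm_eq0 eq_le nrm_ge0 andbT.
by have [c c0 /(_ x)] := c0_val_bound; rewrite x0 mulr0.
Qed.

HB.instance Definition _ := Lmodule_isNormed.Build (scalars R k) c0_space
  c0_normD_subproof c0_normZ_subproof c0_norm_eq0_subproof.

Lemma nrm_c0 (x : c0_space) : nrm x = c0_norm x.
Proof. by rewrite /nrm -[`|x|]/(norm x) sofRK. Qed.

(** The limit is taken in [E]. The estimate [close] is uniform in [n], because each seminorm is
    continuous on [E]; it yields both the decay of the seminorms at the limit and convergence in the
    supremum norm. *)
Lemma c0_complete (F : set_system c0_space) : ProperFilter F -> cauchy F -> cvg F.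
Proof.
move=> FF /(@cauchyP _ _ F FF) Fc.
have Fex (e : R) : 0 < e -> exists x : c0_space, F [set y | nrm (x - y) < e].
  rewrite -(@sofR_gt0 R k) => /Fc[x Fx]; exists x.
  by apply: filterS Fx => y /ball_nrm.
have [c c0 cP] := c0_val_bound.
have : cauchy (c0_val @ F).
  apply/cauchyP => _ /gt0_sofR[e e0 ->].
  have [x Fx] := Fex _ (divr_gt0 e0 c0); exists (c0_val x).
  change (F [set y | ball (c0_val x) (sofR e) (c0_val y)]).
  apply: filterS Fx => y /= xy; apply/ball_nrm.
  rewrite -[_ - _]/(c0_val (x - y)) (le_lt_trans (cP _))//.
  by rewrite mulrC -ltr_pdivlMr// -nrm_c0.
move=> vF; have Fl : cvg (c0_val @ F) by apply: cauchy_cvg.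
set l := lim _ in Fl.
have close (x : c0_space) (e : R) n : F [set y | nrm (x - y) < e] -> p n (c0_val x - l) <= e.
  move=> Fx; apply/ler_addgt0Pr => d d0.
  have [b b0 bP] := sn_bound p n.
  have Fd : F [set y : c0_space | nrm (l - c0_val y) < d / b].
    have /Fl : nbhs l [set y | nrm (l - y) < d / b].
      by apply/nbhs_nrm; exists (d / b); rewrite ?divr_gt0.
    by [].
  have [y [/= xy ly]] := filter_ex (filterI Fx Fd).
  rewrite (_ : _ - l = c0_val (x - y) + (c0_val y - l)); last by rewrite addrA addrNK.
  rewrite (le_trans ((sn_semi p n).1 _ _))// lerD//.
    by rewrite (le_trans (c0_norm_ub _ _))// -nrm_c0 ltW.
  rewrite (le_trans (bP _))// mulrC -ler_pdivlMr//.
  by move: (ltW ly); rewrite nrmBC.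
have lc : l \in vanishing.
  apply/asboolP => e e0; have e2 : 0 < e / 2 by rewrite divr_gt0.
  have [x Fx] := Fex _ e2; have /asboolP/(_ _ e2)[N NP] := c0_mem x.
  exists N => n Nn; rewrite -[l](subKr (c0_val x)) [e]splitr.
  rewrite (le_trans ((sn_semi p n).1 _ _))// lerD ?NP//.
  by rewrite (semiN (sn_semi p n)) close.
apply/cvg_ex; exists (C0Space lc) => A /nbhs_nrm[e e0 eA].
have e2 : 0 < e / 2 by rewrite divr_gt0.
have [x Fx] := Fex _ e2; apply: filterS (Fx) => y /= xy; apply: eA.
rewrite (le_lt_trans (nrm_triangle x _ _))// [e]splitr ler_ltD//.
rewrite nrmBC nrm_c0; apply: c0_norm_le => n; exact: close _ _ n Fx.
Qed.

HB.instance Definition _ := Uniform_isComplete.Build c0_space c0_complete.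

Lemma c0_inclusion : exists i : bop c0_space E, i =1 c0_val.
Proof.
have [c c0 cP] := c0_val_bound.
have [|x|i] := @exists_bop _ _ c0_space E c0_val c (ltW c0); [by []| |by exists i].
by rewrite nrm_c0.
Qed.

(* If [x] is almost extremal for [g] and [y], with much smaller values of the
   first seminorms, is also almost extremal, then [x + y] has norm about [1]
   while [g (x + y)] doubles. *)
Lemma c0_gliding_hump (g : dual c0_space) (e : R) : 0 < e ->
  exists2 d : R, 0 < d & forall x : c0_space,
    nrm x <= 1 -> nrm (c0_val x) < d -> sabs (g x) <= e.
Proof.
pose P (t : R) := 0 < t /\ exists2 d : R, 0 < d & forall x : c0_space,
    nrm x <= 1 -> nrm (c0_val x) < d -> sabs (g x) <= t.
(* If this fails, [x] and [y] both have values above [3 / 4 * t], and their rotated sum [z] has norm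
   at most [5 / 4]: at each index one of the two seminorms is at most [1 / 4] and the other at most
   1. Scaled by [4 / 5], [z] has a value above [6 / 5 * t], against [P t]. *)
have step t : P t -> P (3 / 4 * t).
  move=> [t0 [d d0 td]]; split; first by rewrite mulr_gt0// divr_gt0.
  apply: contrapT => nP.
  have large d' : 0 < d' -> exists x : c0_space,
      [/\ nrm x <= 1, nrm (c0_val x) < d' & 3 / 4 * t < sabs (g x)].
    move=> d'0; apply: contrapT => nx; apply: nP; exists d' => // x x1 xd.
    by rewrite leNgt; apply/negP => xt; apply: nx; exists x.
  have d2 : 0 < d / 2 by rewrite divr_gt0.
  have [x [x1 xd xt]] := large _ d2.
  have q4 : 0 < 4^-1 :> R by rewrite invr_gt0.
  have /asboolP/(_ _ q4)[N NP] := c0_mem x.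
  have [c c0 cP] := seminorms_bound N.
  have m0 : 0 < Num.min (d / 2) (4^-1 / c) by rewrite lt_min d2 divr_gt0.
  have [y [y1 yd yt]] := large _ m0.
  move: yd; rewrite lt_min => /andP[yd yc].
  have [u u1 ux] := exists_phase (g x); have [v v1 vy] := exists_phase (g y).
  pose z : c0_space := u *: x + v *: y.
  have gz : g z = sofR (sabs (g x) + sabs (g y)).
    by rewrite /z bopD !bopZ sofRD -ux -vy.
  have z54 : nrm z <= 5 / 4.
    rewrite nrm_c0; apply: c0_norm_le => n.
    rewrite (le_trans ((sn_semi p n).1 _ _))//= !(sn_semi p n).2 u1 v1 !mul1r.
    have xn : p n (c0_val x) <= 1 by rewrite (le_trans (c0_norm_ub _ _))// -nrm_c0.
    have yn : p n (c0_val y) <= 1 by rewrite (le_trans (c0_norm_ub _ _))// -nrm_c0.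
    have [Nn|nN] := leqP N n; first by have := NP _ Nn; lra.
    have : p n (c0_val y) <= 4^-1.
      by rewrite (le_trans (cP _ _ nN))// mulrC -ler_pdivlMr// ltW.
    by move: xn; lra.
  have zd : nrm (c0_val z) < d.
    rewrite (le_lt_trans (ler_nrmD _ _))//= !nrmZ u1 v1 !mul1r [d]splitr.
    by rewrite ltrD.
  have h45 : 0 <= 4 / 5 :> R by rewrite divr_ge0.
  have z1 : nrm (sofR (4 / 5) *: z) <= 1.
    by rewrite nrmZ sabs_sofR ger0_norm//; lra.
  have z1d : nrm (c0_val (sofR (4 / 5) *: z)) < d.
    rewrite -[c0_val _]/(sofR (4 / 5) *: c0_val z) nrmZ sabs_sofR ger0_norm//.
    by have := nrm_ge0 (c0_val z); lra.
  have := td _ z1 z1d; rewrite bopZ gz -[_ *: _]/(sofR _ * sofR _) -sofRM sabs_sofR.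
  by rewrite ger0_norm ?mulr_ge0 ?addr_ge0 ?sabs_ge0//; lra.
move=> e0; pose T := [set t | P t].
have T0 : T !=set0.
  exists (opnorm g + 1); split; first by rewrite ltr_wpDl ?opnorm_ge0.
  exists 1 => // x x1 _; rewrite (le_trans (ler_functional _ _))// nrm_bop.
  by rewrite (@le_trans _ _ (opnorm g))// ?lerDl// ler_piMr ?opnorm_ge0.
have Tinf : has_inf T by split=> //; exists 0 => t [/ltW].
have T_le0 : inf T <= 0.
  rewrite leNgt; apply/negP => i0.
  have [|t Tt ti] := @inf_lt _ T (4 / 3 * inf T) T0; first lra.
  have : inf T <= 3 / 4 * t by apply: ge_inf; [exact: Tinf.2|exact: step].
  lra.
have [|t [t0 [d d0 td]] te] := @inf_lt _ T e T0; first exact: le_lt_trans T_le0 e0.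
by exists d => // x x1 xd; rewrite (le_trans (td _ x1 xd))// ltW.
Qed.

(** The gliding hump gives [gM], which says that [g], placed on the diagonal of the product of the
    space with [E], is dominated by the seminorm [q]. For a dominated extension [G], the part
    [G (0, y)] is a bounded functional on [E], and its difference from [g] is controlled by
    [G (x, 0)], of norm at most [e]. *)
Lemma c0_dual_dense (g : dual c0_space) (e : R) : 0 < e ->
  exists f : dual E, forall x, nrm x <= 1 -> sabs (f (c0_val x) - g x) <= e.
Proof.
move=> e0; have [d d0 gd] := c0_gliding_hump g e0.
(* For [y] in the unit ball with [d <= nrm (c0_val y)], which the gliding hump leaves out,
   [opnorm g] is at most [M * nrm (c0_val y)]. *)
pose M := opnorm g / d.
have M0 : 0 <= M by rewrite divr_ge0 ?opnorm_ge0// ltW.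
have gM x : nrm (g x) <= e * nrm x + M * nrm (c0_val x).
  have [->|x0] := eqVneq x 0.
    by rewrite bop0 nrm0 addr_ge0// mulr_ge0 ?nrm_ge0// ltW.
  have nx : 0 < nrm x by rewrite nrm_gt0.
  pose y := sofR (nrm x)^-1 *: x.
  have y1 : nrm y <= 1.
    by rewrite nrmZ sabs_sofR ger0_norm ?invr_ge0 ?nrm_ge0// mulVf ?gt_eqF.
  have gy : nrm (g y) <= e + M * nrm (c0_val y).
    have [yd|dy] := ltP (nrm (c0_val y)) d.
      by rewrite (le_trans (gd _ y1 yd))// lerDl mulr_ge0 ?nrm_ge0.
    rewrite (@le_trans _ _ (opnorm g))//.
      by rewrite (le_trans (ler_nrm_bop _ _))// ler_piMr ?opnorm_ge0.
    rewrite (@le_trans _ _ (M * nrm (c0_val y)))//; last by rewrite lerDr ltW.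
    by rewrite /M mulrAC ler_pdivlMr// ler_wpM2l ?opnorm_ge0.
  have xy : x = sofR (nrm x) *: y.
    by rewrite scalerA -sofRM mulfV ?gt_eqF// sofR1 scale1r.
  have cx : nrm (c0_val x) = nrm x * nrm (c0_val y).
    by rewrite {1}xy -[c0_val _]/(sofR (nrm x) *: c0_val y) nrmZ sabs_sofR ger0_norm ?nrm_ge0.
  rewrite {1}xy bopZ nrmZ sabs_sofR ger0_norm ?nrm_ge0// cx mulrCA [e * _]mulrC -mulrDr.
  by rewrite ler_wpM2l ?nrm_ge0.
pose q (w : c0_space * E) := e * nrm w.1 + M * nrm w.2.
have qs : seminorm q.
  split=> [v w|a v].
    by rewrite /q addrACA -!mulrDr lerD// ler_wpM2l ?ler_nrmD// ltW.
  by rewrite /q !nrmZ mulrDr !(mulrCA (sabs a)).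
have [||x|G [linG Gq GL]] := @hahn_banach _ _ _ _ qs c0_space (fun x => (x, c0_val x)) g.
- by [].
- exact: bop_linear.
- exact: gM.
have [|y|f fG _] := @exists_bop _ _ E (sline R k) (fun y => G (0, y)) M M0.
- by move=> a x y; rewrite -linG; congr (G (_, _)); rewrite /= scaler0 addr0.
- by rewrite (le_trans (Gq _))// /q /= nrm0 mulr0 add0r.
exists f => x x1; rewrite fG -GL -(linear_fun_B linG) -[(_, _) - _]/(0 - x, c0_val x - c0_val x).
rewrite (le_trans (Gq _))// /q /= subrr nrm0 mulr0 addr0 sub0r nrmN.
by rewrite ler_piMr// ltW.
Qed.

End C0Space.

Lemma exists_half_lt (R : realType) (e : R) : 0 < e -> exists N, forall n, (N <= n)%N -> (2 ^+ n)^-1 < e.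
Proof.
move=> e0; exists (Num.truncn e^-1) => n Nn.
rewrite invf_plt ?posrE ?exprn_gt0// (lt_le_trans (truncnS_gt _))// -natrX ler_nat.
by rewrite (leq_ltn_trans Nn)// ltn_expl.
Qed.

(* [p n] below measures the distance from [x] to multiples of a [(2^n)^-2]-net
   of [C], penalising large coefficients.  On [C] it decays like [2^-n], a bound
   on all the [p n] forces total boundedness in [E], and the decay condition
   defining [c0_space] makes the restrictions of [dual E] dense in its dual. *)
Section Admissible.
Context {R : realType} {k : scalar_kind} (E : Banach R k) (C : set E).
Hypothesis Ct : totally_bounded C.

Lemma admissible_exists : exists (W : Banach R k) (i : bop W E),
  admissible C i /\ totally_bounded (i @^-1` C).
Proof.
pose h (n : nat) : R := 2 ^+ n.
have h0 n : 0 < h n by rewrite exprn_gt0.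
have /choice[s sP] n : exists s : seq E, forall x, C x ->
    exists2 y, y \in s & nrm (x - y) < (h n ^+ 2)^-1.
  by apply: Ct; rewrite invr_gt0 exprn_gt0.
pose U n := 'I_(size (s n)) -> sline R k.
pose y n j := tnth (in_tuple (s n)) j.
(* For [x] in [C], the nearest centre with coefficient 1 costs at most the mean of [1 / h n] and
   [h n / h n ^+ 2], that is [1 / h n]. The factor [1 / 2] and the mesh [(h n ^+ 2)^-1] are chosen
   for this. *)
pose N n (c : U n) x := (\sum_j nrm (c j) / h n + h n * nrm (x - \sum_j c j *: y n j)) / 2.
have ND n c d x z : N n (c + d) (x + z) <= N n c x + N n d z.
  rewrite /N -mulrDl ler_pM2r ?invr_gt0// addrACA lerD//.
    rewrite -big_split/=; apply: ler_sum => j _.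
    by rewrite -mulrDl ler_pM2r ?invr_gt0// ler_nrmD.
  rewrite -mulrDr ler_pM2l//.
  have -> : \sum_j (c + d) j *: y n j = \sum_j c j *: y n j + \sum_j d j *: y n j.
    by rewrite -big_split/=; apply: eq_bigr => j _; rewrite -scalerDl.
  by rewrite opprD addrACA ler_nrmD.
have NZ n a (c : U n) x : N n (a *: c) (a *: x) = sabs a * N n c x.
  rewrite /N mulrA mulrDr; congr ((_ + _) / 2).
    by rewrite mulr_sumr; apply: eq_bigr => j _; rewrite nrmZ mulrA.
  rewrite mulrCA -nrmZ scalerBr scaler_sumr; congr (_ * nrm (_ - _)).
  by apply: eq_bigr => j _; rewrite scalerA.
pose p n := inf_semi (N n).
have ps n : seminorm (p n) := seminorm_inf (@ND n) (@NZ n).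
have p_le n c x : p n x <= N n c x := inf_semi_le (@ND n) (@NZ n) c x.
have ph n x : p n x <= h n * nrm x.
  rewrite (le_trans (p_le n 0 x))// /N big1 => [|j _]; last by rewrite nrm0 mul0r.
  rewrite big1 => [|j _]; last by rewrite scale0r.
  rewrite add0r subr0 ler_pdivrMr// ler_peMr ?ler1n// mulr_ge0 ?nrm_ge0//.
  exact: ltW.
(* The summand 1 keeps [Y n] positive for an empty net and gives [1 <= Y 0], by which the residual
   is absorbed in [p0]. *)
pose Y n := \sum_j nrm (y n j) + 1.
have Y0 n : 0 < Y n by rewrite ltr_wpDl// sumr_ge0// => j _; exact: nrm_ge0.
have comb n (c : U n) b : 0 <= b -> (forall j, nrm (c j) <= b) ->
    nrm (\sum_j c j *: y n j) <= b * Y n.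
  move=> b0 cb; rewrite (le_trans (ler_nrm_sum _))// /Y mulrDr mulr1 mulr_sumr.
  rewrite ler_wpDr//; apply: ler_sum => j _.
  by rewrite nrmZ ler_wpM2r ?nrm_ge0// -nrm_sline.
have p0 : exists2 c : R, 0 < c & forall x, nrm x <= c * p 0%N x.
  exists (2 * Y 0%N) => [|x]; first by rewrite mulr_gt0.
  rewrite mulrC -ler_pdivrMr ?mulr_gt0//; apply: inf_semi_ge => c.
  rewrite ler_pdivrMr ?mulr_gt0// /N /h expr0 mul1r.
  set S := \sum_j _ *: _; set T := \sum_j _ / _.
  have ST : nrm S <= T * Y 0%N.
    apply: comb => [|j]; first by rewrite sumr_ge0// => j _; rewrite divr_ge0 ?nrm_ge0.
    rewrite /T (bigD1 j)//= divr1 lerDl.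
    by rewrite sumr_ge0// => i _; rewrite divr_ge0 ?nrm_ge0.
  have Y1 : 1 <= Y 0%N by rewrite lerDr sumr_ge0// => j _; exact: nrm_ge0.
  have : nrm (x - S) <= nrm (x - S) * Y 0%N by rewrite ler_peMr ?nrm_ge0.
  by have := ler_nrmD (x - S) S; rewrite subrK; lra.
have pC n x : C x -> p n x <= (h n)^-1.
  move=> /(sP n)[z zs xz].
  have zi : (index z (s n) < size (s n))%N by rewrite index_mem.
  pose j0 := Ordinal zi.
  have yz : y n j0 = z by rewrite /y (tnth_nth 0)/= nth_index.
  pose d : U n := fun j => (j == j0)%:R.
  have d1 : d j0 = 1 by rewrite /d eqxx.
  have d0 j : j != j0 -> d j = 0 by rewrite /d => /negPf ->.
  rewrite (le_trans (p_le n d x))// /N.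
  rewrite (bigD1 j0)//= big1 => [|j /d0 ->]; last by rewrite nrm0 mul0r.
  rewrite (bigD1 j0)//= [X in x - (_ + X)]big1 => [|j /d0 ->]; last by rewrite scale0r.
  rewrite d1 scale1r yz !addr0 [nrm _]sabs1 mul1r.
  rewrite ler_pdivrMr// mulr_natr mulr2n lerD2l.
  rewrite mulrC -ler_pdivlMr// -invfM -expr2 ltW//.
pose P : seminorm_seq E := SeminormSeq ps
  (fun n => ex_intro2 _ _ (h n) (h0 n) (ph n)) p0.
have [i iE] := c0_inclusion P.
have pW n (w : c0_space P) : p n (i w) <= nrm w.
  by rewrite iE nrm_c0; exact: (c0_norm_ub w n).
have CW x : C x -> exists2 w, nrm w <= 1 & i w = x.
  move=> Cx.
  have xP : x \in vanishing P.
    apply/asboolP => e e0; have [m mP] := exists_half_lt e0.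
    by exists m => n mn; rewrite (le_trans (pC _ _ Cx))// ltW// mP.
  exists (C0Space xP); last by rewrite iE.
  rewrite nrm_c0; apply: c0_norm_le => n; rewrite (le_trans (pC _ _ Cx))//.
  by rewrite invf_le1// exprn_ege1// ler1n.
exists (c0_space P), i; split; first split.
- by move=> v w; rewrite !iE => /val_inj.
- apply/compact_opP; apply: totally_bounded_coord => e e0.
  (* On the unit ball [p n] is at most 1, so some coefficients cost less than 2; this leaves
     residuals at most [4 / h n], below [e / 4]. The bounded coefficients are the coordinates. *)
  have [n nP] := exists_half_lt (divr_gt0 e0 (ltr0n _ 16)).
  have {nP} hn := nP n (leqnn n).
  have /choice[c cP] x : exists c : U n, (i @` unit_ball (c0_space P)) x -> N n c x < 2.
    have [[w /unit_ballE w1 <-]|nx] := pselect ((i @` unit_ball (c0_space P)) x); last first.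
      by exists 0.
    have [|c c2] := @inf_semi_lt _ _ _ _ (N n) (i w) 2; last by exists c.
    by rewrite (le_lt_trans (pW n w))// (le_lt_trans w1)// ltr1n.
  have cN x : (i @` unit_ball (c0_space P)) x ->
      (forall j, nrm (c x j) <= 4 * h n) /\ nrm (x - \sum_j c x j *: y n j) <= 4 / h n.
    move=> /cP; rewrite /N ltr_pdivrMr// => c4.
    have S0 : 0 <= \sum_j nrm (c x j) / h n.
      by rewrite sumr_ge0// => j _; rewrite divr_ge0 ?nrm_ge0// ltW.
    have D0 : 0 <= h n * nrm (x - \sum_j c x j *: y n j).
      by rewrite mulr_ge0 ?nrm_ge0// ltW.
    split=> [j|].
      rewrite -ler_pdivrMr//; apply: (@le_trans _ _ (\sum_j nrm (c x j) / h n)); last lra.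
      rewrite (bigD1 j)//= lerDl sumr_ge0// => l _.
      by rewrite divr_ge0 ?nrm_ge0// ltW.
    by rewrite ler_pdivlMr// mulrC; lra.
  exists 'I_(size (s n)), c, (4 * h n), (e / 4 / Y n); split.
  + by rewrite !divr_gt0.
  + by move=> x j /cN[cx _]; exact: cx.
  + move=> x z /cN[_ xc] /cN[_ zc] cd.
    have -> : x - z = (x - \sum_j c x j *: y n j) + \sum_j (c x j - c z j) *: y n j
        - (z - \sum_j c z j *: y n j).
      have -> : \sum_j (c x j - c z j) *: y n j =
          \sum_j c x j *: y n j - \sum_j c z j *: y n j.
        by rewrite -sumrB; apply: eq_bigr => j _; rewrite scalerBl.
      exact: telescope3.
    have cY : nrm (\sum_j (c x j - c z j) *: y n j) <= e / 4.
      rewrite -[e / 4](divfK (lt0r_neq0 (Y0 n))).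
      apply: (comb n (fun j => c x j - c z j)) => [|j]; first by rewrite !divr_ge0 ?ltW.
      exact: ltW (cd j).
    rewrite (le_lt_trans (ler_nrmB _ _))//.
    rewrite (@le_lt_trans _ _ (4 / h n + e / 4 + 4 / h n))//; last by lra.
    by rewrite lerD// (le_trans (ler_nrmD _ _))// lerD.
- by move=> x /CW[w w1 wx]; exists w => //; apply/unit_ballE.
- move=> g e e0; have e2 : 0 < e / 2 by rewrite divr_gt0.
  have [f fP] := c0_dual_dense g e2; exists f => w /unit_ballE w1.
  rewrite iE (@le_lt_trans _ _ (e / 2))//; last by lra.
  exact: fP.
apply: (@totally_bounded_pullback _ _ _ _ i); last first.
  by apply: totally_boundedS Ct => _ [w Cw <-].
move=> e e0; have e3 : 0 < e / 3 by rewrite divr_gt0.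
(* From index [m] on, the seminorms are small on all of [C]; the finitely many earlier ones are
   dominated by the norm of [E]. *)
have [m mP] := exists_half_lt e3.
have [c c0 cP] := seminorms_bound P m.
exists (e / 2 / c) => [|v w Cv Cw vw]; first by rewrite !divr_gt0.
rewrite (@le_lt_trans _ _ (2 / 3 * e))//; last by lra.
rewrite nrm_c0; apply: c0_norm_le => n; rewrite -[c0_val _]iE.
have [mn|nm] := leqP m n.
  rewrite bopB (le_trans ((ps n).1 _ _))// (semiN (ps n)).
  have := pC n _ Cv; have := pC n _ Cw; have := mP n mn; rewrite /h; lra.
rewrite (le_trans (cP _ _ nm))// (@le_trans _ _ (e / 2))//; last by lra.
by rewrite mulrC -ler_pdivlMr// ltW.
Qed.

End Admissible.

(** * Finite rank operators and composition norms *)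

Section ProductSpace.
Context {R : realType} {k : scalar_kind}.

Lemma nrm_pair (X Y : normedModType (scalars R k)) (p : X * Y) :
  nrm p = Num.max (nrm p.1) (nrm p.2).
Proof.
apply: (@sofR_inj R k); rewrite sofR_nrm prod_normE.
have [yx|xy] := leP (nrm p.2) (nrm p.1); rewrite sofR_nrm.
- by rewrite max_l// -ler_nrm.
- by rewrite max_r// -ler_nrm ltW.
Qed.

HB.instance Definition _ (X Y : Banach R k) := Pointed.on (X * Y)%type.

Lemma prod_complete (X Y : Banach R k) (F : set_system (X * Y)%type) :
  ProperFilter F -> cauchy F -> cvg F.
Proof.
move=> FF /(@cauchyP _ _ F FF) Fc.
have Fex (e : R) : 0 < e -> exists x : X * Y, F [set y | nrm (x - y) < e].
  rewrite -(@sofR_gt0 R k) => /Fc[x Fx]; exists x.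
  by apply: filterS Fx => y /ball_nrm.
have part (Z : Banach R k) (pr : X * Y -> Z) :
    (forall p q, nrm (pr p - pr q) <= nrm (p - q)) ->
    exists l : Z, forall e : R, 0 < e -> F [set p | nrm (l - pr p) < e].
  move=> pr_le; have prc : cauchy (pr @ F).
    apply/cauchyP => _ /gt0_sofR[e e0 ->]; have [x Fx] := Fex _ e0.
    exists (pr x); change (F [set y | ball (pr x) (sofR e) (pr y)]).
    by apply: filterS Fx => y /= xy; apply/ball_nrm; rewrite (le_lt_trans (pr_le _ _)).
  have prl : cvg (pr @ F) by apply: cauchy_cvg.
  set l := lim _ in prl; exists l => e e0.
  have /prl : nbhs l [set y | nrm (l - y) < e] by apply/nbhs_nrm; exists e.
  by [].
have [|a Fa] := part X fst; first by move=> p q; rewrite nrm_pair le_max lexx.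
have [|b Fb] := part Y snd; first by move=> p q; rewrite nrm_pair le_max lexx orbT.
apply/cvg_ex; exists (a, b) => A /nbhs_nrm[e e0 eA].
apply: filterS (filterI (Fa _ e0) (Fb _ e0)) => p [/= pa pb]; apply: eA.
by rewrite nrm_pair/= gt_max pa pb.
Qed.

HB.instance Definition _ (X Y : Banach R k) :=
  Uniform_isComplete.Build (X * Y)%type (@prod_complete X Y).

(** The last clause records the maximum norm: two contractions with the same source combine into a
    contraction into [Z]. *)
Lemma exists_biproduct (X Y : Banach R k) : exists (Z : Banach R k)
    (i : bop X Z) (j : bop Y Z) (p : bop Z X) (q : bop Z Y),
  [/\ [/\ bcomp p i = bid X, bcomp q j = bid Y, bcomp p j = 0 & bcomp q i = 0],
      opnorm i <= 1 /\ opnorm j <= 1, opnorm p <= 1 /\ opnorm q <= 1 &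
      forall z c, nrm (p z) <= c -> nrm (q z) <= c -> nrm z <= c].
Proof.
pose Z : Banach R k := (X * Y)%type.
have [||i iE i1] := @exists_bop _ _ X Z (fun x => (x, 0)) 1 ler01.
- by move=> a x y; congr (_, _); rewrite /= scaler0 addr0.
- by move=> x; rewrite mul1r nrm_pair/= nrm0 ge_max lexx nrm_ge0.
have [||j jE j1] := @exists_bop _ _ Y Z (fun y => (0, y)) 1 ler01.
- by move=> a x y; congr (_, _); rewrite /= scaler0 addr0.
- by move=> x; rewrite mul1r nrm_pair/= nrm0 ge_max lexx nrm_ge0.
have [||p pE p1] := @exists_bop _ _ Z X fst 1 ler01; first by [].
  by move=> z; rewrite mul1r nrm_pair le_max lexx.
have [||q qE q1] := @exists_bop _ _ Z Y snd 1 ler01; first by [].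
  by move=> z; rewrite mul1r nrm_pair le_max lexx orbT.
exists Z, i, j, p, q; split=> //.
  by split; apply: bop_eq => x; rewrite /= ?pE ?qE ?iE ?jE.
by move=> z c; rewrite pE qE nrm_pair ge_max => -> ->.
Qed.

End ProductSpace.

(** * Finite rank operators as sums of rank one operators *)

Section FiniteRank.
Context {R : realType} {k : scalar_kind}.
Implicit Types X Y Z : Banach R k.

Lemma line_subproof Y (y : Y) :
  (fun t : sline R k => (t : scalars R k) *: y) \in bounded_operator (sline R k) Y.
Proof.
have [a s t|t|T TE _] := @exists_bop _ _ (sline R k) Y
    (fun t : sline R k => (t : scalars R k) *: y) (nrm y) (nrm_ge0 y).
- by rewrite scalerDl scalerA.
- by rewrite nrmZ mulrC.
- by rewrite -(funext TE); exact: bop_mem.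
Qed.

Definition line Y (y : Y) : bop (sline R k) Y := Bop (line_subproof y).

Lemma opnorm_line Y (y : Y) : opnorm (line y) <= nrm y.
Proof. by apply: opnorm_ler => [|t]; rewrite ?nrm_ge0// nrmZ mulrC. Qed.

Definition rank1 X Y (f : dual X) (y : Y) : bop X Y := bcomp (line y) f.

Lemma rank1E X Y (f : dual X) (y : Y) x : rank1 f y x = (f x : scalars R k) *: y.
Proof. by []. Qed.

Lemma sum_seqE X Y (I : Type) (s : seq I) (F : I -> bop X Y) x :
  (\sum_(i <- s) F i) x = \sum_(i <- s) F i x.
Proof. by elim/big_ind2: _ => // S t T u <- <-. Qed.

Lemma finite_rank_sum X Y (s : seq (dual X * Y)) :
  finite_rank (\sum_(p <- s) rank1 p.1 p.2).
Proof.
exists (size s), (fun i => (tnth (in_tuple s) i).2) => x.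
exists (fun i => (tnth (in_tuple s) i).1 x).
by rewrite sum_seqE big_tnth.
Qed.

(** The coefficients in [finite_rank] need not depend linearly, or even continuously, on [x], so
    they are rebuilt by induction on the number of generators. Splitting off a value [v] of [T] by a
    projection leaves an operator into the span of the projected generators [z i]. The expansion of
    [v] becomes a nontrivial relation between these, which makes one of them redundant. *)
Lemma finite_rankP X Y (T : bop X Y) : finite_rank T ->
  exists s : seq (dual X * Y), T = \sum_(p <- s) rank1 p.1 p.2.
Proof.
move=> [n [y]]; elim: n T y => [|n IH] T y Ty.
  exists [::]; rewrite big_nil; apply: bop_eq => x.
  by have [c ->] := Ty x; rewrite big_ord0.
have [->|/eqP T0] := pselect (T = 0); first by exists [::]; rewrite big_nil.
have [x0 v0] : exists x, T x != 0.
  apply: contrapT => nx; move: T0; rewrite (_ : T = 0) ?eqxx//.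
  by apply: bop_eq => x; apply/eqP; apply: contrapT => /negP Tx; apply: nx; exists x.
set v := T x0 in v0; have [c vc] := Ty x0; rewrite -/v in vc.
have nv : 0 < nrm v by rewrite nrm_gt0.
have [g _ gv] := exists_norming v.
pose f : dual Y := sofR (nrm v)^-1 *: g.
have fv : f v = 1.
  by rewrite -[f v]/(sofR _ * g v) gv -sofRM mulVf ?gt_eqF// sofR1.
pose z i := y i - (f (y i) : scalars R k) *: v.
have zsum (d : 'I_n.+1 -> scalars R k) :
    \sum_i d i *: z i = \sum_i d i *: y i - (f (\sum_i d i *: y i) : scalars R k) *: v.
  pose P w := w - (f w : scalars R k) *: v.
  have PD : {morph P : x w / x + w}.
    by move=> x w; rewrite /P bopD scalerDl opprD addrACA.
  have P0 : P 0 = 0 by rewrite /P bop0 scale0r subrr.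
  rewrite -[RHS]/(P _) (big_morph P PD P0); apply: eq_bigr => i _.
  by rewrite /P bopZ scalerBr scalerA.
have [i0 ci0] : exists i, c i != 0.
  apply: contrapT => nc; move: v0; rewrite vc big1 ?eqxx// => i _.
  have -> : c i = 0; last by rewrite scale0r.
  by apply/eqP; apply: contrapT => /negP ci; apply: nc; exists i.
have cz : \sum_i c i *: z i = 0 by rewrite zsum -vc fv scale1r subrr.
have [|s sE] := IH (T - rank1 (bcomp f T) v) (fun j => z (lift i0 j)).
  move=> x; have [d Tx] := Ty x.
  exists (fun j => d (lift i0 j) - d i0 / c i0 * c (lift i0 j)).
  have -> : (T - rank1 (bcomp f T) v) x = T x - (f (T x) : scalars R k) *: v by [].
  rewrite Tx -zsum.
  have <- : \sum_i (d i - d i0 / c i0 * c i) *: z i = \sum_i d i *: z i.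
    under eq_bigr do rewrite scalerBl -scalerA.
    by rewrite sumrB -scaler_sumr cz scaler0 subr0.
  by rewrite (bigD1_ord i0)//= divfK// subrr scale0r add0r.
exists ((bcomp f T, v) :: s); rewrite big_cons -sE /=.
by rewrite addrC subrK.
Qed.

Lemma compact_functional X (f : dual X) : compact_op X (sline R k) f.
Proof.
apply/compact_opP; apply: totally_bounded_coord => e e0.
exists unit, (fun t _ => t), (opnorm f), e; split=> //.
  move=> _ _ [x /unit_ballE x1 <-]; rewrite (le_trans (ler_functional _ _))//.
  by rewrite nrm_bop ler_piMr ?opnorm_ge0.
by move=> x y _ _ /(_ tt).
Qed.

Lemma adjoint_comp X Y Z (U : bop Y Z) (V : bop X Y) :
  adjoint (bcomp U V) = bcomp (adjoint V) (adjoint U).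
Proof. by apply: bop_eq => f; apply: bop_eq. Qed.

Lemma bcompA X Y Z Z' (S : bop Z Z') (U : bop Y Z) (V : bop X Y) :
  bcomp S (bcomp U V) = bcomp (bcomp S U) V.
Proof. exact: bop_eq. Qed.

Lemma compact_line Y (y : Y) : compact_op (sline R k) Y (line y).
Proof.
have -> : line y = bcomp (line y) (bid (sline R k)) by exact: bop_eq.
by apply: compact_comp_l; exact: compact_functional (bid (sline R k)).
Qed.

(** Evaluation at 1 identifies the dual of the scalar field with the scalar field, which reduces the
    adjoint of a rank one operator to a [line]. *)
Lemma adjoint_functional X (f : dual X) :
  adjoint f = bcomp (line f) (kappa (sline R k) 1).
Proof.
apply: bop_eq => g; apply: bop_eq => x.
rewrite -[RHS]/((g 1 : scalars R k) * f x) mulrC adjointE.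
by rewrite -[X in g X]mulr1; exact: bopZ.
Qed.

End FiniteRank.

(** * Quasi-norm estimates for the two composition ideals *)

Section IdealCalculus.
Context {R : realType} {k : scalar_kind} (A : operator_ideal R k).
Implicit Types X Y Z W : Banach R k.
Let a := oi_norm A.

Lemma ideal_l X Y Z (U : bop Y Z) (S : bop X Y) :
  oi_mem A S -> oi_mem A (bcomp U S) /\ a (bcomp U S) <= opnorm U * a S.
Proof.
move=> AS; have -> : bcomp U S = bcomp U (bcomp S (bid X)) by exact: bop_eq.
split; first exact: oi_comp.
rewrite (le_trans (oi_normM _ _ AS))// ler_piMr ?opnorm_id//.
by rewrite mulr_ge0 ?opnorm_ge0 ?oi_norm_ge0.
Qed.

Lemma ideal_r X Y Z (S : bop Y Z) (V : bop X Y) :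
  oi_mem A S -> oi_mem A (bcomp S V) /\ a (bcomp S V) <= a S * opnorm V.
Proof.
move=> AS; have -> : bcomp S V = bcomp (bid Z) (bcomp S V) by exact: bop_eq.
split; first exact: oi_comp.
rewrite (le_trans (oi_normM _ _ AS))// ler_wpM2r ?opnorm_ge0//.
by rewrite ler_piMl ?opnorm_id// oi_norm_ge0.
Qed.

Lemma ideal_line Y (y : Y) : oi_mem A (line y) /\ a (line y) <= nrm y.
Proof.
have -> : line y = bcomp (line y) (bid (sline R k)) by exact: bop_eq.
have [Al al] := ideal_l (line y) (oi_id A); split=> //.
by rewrite (le_trans al)// /a oi_norm_id mulr1 opnorm_line.
Qed.

Lemma ideal_rank1 X Y (f : dual X) (y : Y) : oi_mem A (rank1 f y).
Proof. by apply: (ideal_r _ _).1; exact: (ideal_line y).1. Qed.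

Lemma ideal_finite_rank X Y (T : bop X Y) : finite_rank T -> oi_mem A T.
Proof.
move=> /finite_rankP[s ->]; elim: s => [|p s IH].
  rewrite big_nil; have -> : 0 = rank1 0 0 :> bop X Y; last exact: ideal_rank1.
  by apply: bop_eq => x; rewrite rank1E scaler0.
by rewrite big_cons; apply: oi_add IH; exact: ideal_rank1.
Qed.

(** The condition that the composition norm is below [e], with the compact factor normalised. Under
    this normalisation the bounds of two factorizations through a biproduct add up. *)
Definition small_AK X Y (T : bop X Y) (e : R) :=
  exists Z (U : bop Z Y) (V : bop X Z),
    [/\ oi_mem A U, compact_op X Z V, T = bcomp U V, opnorm V <= 1 & a U < e].

Definition small_KAd X Y (T : bop X Y) (e : R) :=
  exists Z (U : bop Z Y) (V : bop X Z),
    [/\ compact_op Z Y U, oi_mem A (adjoint V), T = bcomp U V, opnorm U <= 1 &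
        a (adjoint V) < e].

(** Normalising a factor by its own norm [m] fails when [m = 0]; the strict inequality leaves room
    for a positive [t]. *)
Lemma exists_scale (m b e : R) : 0 <= m -> 0 <= b -> m * b < e ->
  exists t, [/\ 0 < t, m <= t & t * b < e].
Proof.
move=> m0 b0 mbe; have b1 : 0 < b + 1 by rewrite ltr_wpDl.
pose d := (e - m * b) / (b + 1).
have d0 : 0 < d by rewrite divr_gt0// subr_gt0.
have db : d * (b + 1) = e - m * b by rewrite divfK ?gt_eqF.
by exists (m + d); split; nra.
Qed.

Lemma opnorm_scale X (t : R) : 0 <= t -> opnorm (sofR t *: bid X) <= t.
Proof.
by move=> t0; rewrite opnormZ sabs_sofR ger0_norm// ler_piMr ?opnorm_id.
Qed.

Lemma scale_cancel X Y Z (U : bop Y Z) (V : bop X Y) (t : R) : t != 0 ->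
  bcomp (bcomp U (sofR t *: bid Y)) (bcomp (sofR t^-1 *: bid Y) V) = bcomp U V.
Proof.
move=> t0; apply: bop_eq => x.
rewrite -[LHS]/(U (sofR t *: (sofR t^-1 *: V x))) scalerA -sofRM mulfV//.
by rewrite sofR1 scale1r.
Qed.

Lemma small_AK_mul X Y Z (U : bop Z Y) (V : bop X Z) (e : R) :
  oi_mem A U -> compact_op X Z V -> a U * opnorm V < e -> small_AK (bcomp U V) e.
Proof.
move=> AU Vc UVe.
have [|t [t0 Vt tU]] := exists_scale (opnorm_ge0 V) (oi_norm_ge0 AU) (e := e).
  by rewrite mulrC.
exists Z, (bcomp U (sofR t *: bid Z)), (bcomp (sofR t^-1 *: bid Z) V).
have [AU' aU'] := ideal_r (sofR t *: bid Z) AU; split=> //.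
- exact: compact_comp_l.
- by rewrite scale_cancel ?gt_eqF.
- rewrite (le_trans (opnorm_comp _ _))//.
  rewrite (@le_trans _ _ (t^-1 * opnorm V))//.
    by rewrite ler_wpM2r ?opnorm_ge0// opnorm_scale ?invr_ge0 ?ltW.
  by rewrite ler_pdivrMl// mulr1.
- rewrite (le_lt_trans aU')// (le_lt_trans _ tU)// mulrC.
  by rewrite ler_wpM2r ?oi_norm_ge0// opnorm_scale ?ltW.
Qed.

Lemma small_KAd_mul X Y Z (U : bop Z Y) (V : bop X Z) (e : R) :
  compact_op Z Y U -> oi_mem A (adjoint V) -> opnorm U * a (adjoint V) < e ->
  small_KAd (bcomp U V) e.
Proof.
move=> Uc AV UVe.
have [t [t0 Ut tV]] := exists_scale (opnorm_ge0 U) (oi_norm_ge0 AV) UVe.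
have ti0 : 0 < t^-1 by rewrite invr_gt0.
exists Z, (bcomp U (sofR t^-1 *: bid Z)), (bcomp (sofR t *: bid Z) V).
rewrite adjoint_comp.
have [AV' aV'] := ideal_r (adjoint (sofR t *: bid Z)) AV; split=> //.
- exact: compact_comp_r.
- by have := scale_cancel U V (lt0r_neq0 ti0); rewrite invrK.
- rewrite (le_trans (opnorm_comp _ _))//.
  rewrite (@le_trans _ _ (opnorm U * t^-1))//.
    by rewrite ler_wpM2l ?opnorm_ge0// opnorm_scale ?ltW.
  by rewrite ler_pdivrMr// mul1r.
- rewrite (le_lt_trans aV')// (le_lt_trans _ tV)// mulrC.
  rewrite ler_wpM2r ?oi_norm_ge0// (le_trans (opnorm_adjoint _))//.
  by rewrite opnorm_scale ?ltW.
Qed.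

Lemma norm_AK_lt X Y (T : bop X Y) (e : R) :
  (norm_AK A T < e%:E)%E <-> small_AK T e.
Proof.
split.
  move=> /ereal_inf_lt[_ [Z [U [V [AU Vc -> ->]]]]]; rewrite lte_fin.
  exact: small_AK_mul.
move=> [Z [U [V [AU Vc TE V1 Ue]]]].
apply: (@le_lt_trans _ _ (a U * opnorm V)%:E).
  by apply: ereal_inf_lbound; exists Z, U, V.
by rewrite lte_fin (le_lt_trans _ Ue)// ler_piMr// oi_norm_ge0.
Qed.

Lemma norm_KAd_lt X Y (T : bop X Y) (e : R) :
  (norm_KAd A T < e%:E)%E <-> small_KAd T e.
Proof.
split.
  move=> /ereal_inf_lt[_ [Z [U [V [Uc AV -> ->]]]]]; rewrite lte_fin.
  exact: small_KAd_mul.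
move=> [Z [U [V [Uc AV TE U1 Ve]]]].
apply: (@le_lt_trans _ _ (opnorm U * a (adjoint V))%:E).
  by apply: ereal_inf_lbound; exists Z, U, V.
by rewrite lte_fin (le_lt_trans _ Ve)// ler_piMl// oi_norm_ge0.
Qed.

(** Both factorizations are put through a biproduct. Its maximum norm keeps the compact factor a
    contraction, so the constant is that of the quasi-norm of [A]. *)
Lemma small_AKD : exists2 c : R, 0 < c & forall X Y (S T : bop X Y) d e,
  small_AK S d -> small_AK T e -> small_AK (S + T) (c * (d + e)).
Proof.
have [c c1 cD] := oi_normD A; have c0 : 0 < c by exact: lt_le_trans c1.
exists c => // X Y S T d e [Z1 [U1 [V1 [AU1 V1c -> V11 U1d]]]] [Z2 [U2 [V2 [AU2 V2c -> V21 U2e]]]].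
have [Z [i [j [p [q [[pi qj pj qi] [i1 j1] [p1 q1] Zle]]]]]] := exists_biproduct Z1 Z2.
have pz x : p (i (V1 x) + j (V2 x)) = V1 x.
  by rewrite bopD -[p (i _)]/(bcomp p i _) -[p (j _)]/(bcomp p j _) pi pj addr0.
have qz x : q (i (V1 x) + j (V2 x)) = V2 x.
  by rewrite bopD -[q (i _)]/(bcomp q i _) -[q (j _)]/(bcomp q j _) qi qj add0r.
have [AU1p aU1p] := ideal_r p AU1; have [AU2q aU2q] := ideal_r q AU2.
exists Z, (bcomp U1 p + bcomp U2 q), (bcomp i V1 + bcomp j V2); split.
- exact: oi_add.
- by apply: compactD; exact: compact_comp_l.
- apply: bop_eq => x.
  rewrite -[RHS]/(U1 (p (i (V1 x) + j (V2 x))) + U2 (q (i (V1 x) + j (V2 x)))).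
  by rewrite pz qz.
- apply: opnorm_ler => // x; rewrite mul1r.
  apply: Zle.
    change (nrm (p (i (V1 x) + j (V2 x))) <= nrm x); rewrite pz.
    by rewrite (le_trans (ler_nrm_bop _ _))// ler_piMl ?nrm_ge0.
  change (nrm (q (i (V1 x) + j (V2 x))) <= nrm x); rewrite qz.
  by rewrite (le_trans (ler_nrm_bop _ _))// ler_piMl ?nrm_ge0.
- rewrite (le_lt_trans (cD _ _ _ _ AU1p AU2q))// ltr_pM2l// ltrD//.
    by rewrite (le_lt_trans aU1p)// (le_lt_trans _ U1d)// ler_piMr// oi_norm_ge0.
  by rewrite (le_lt_trans aU2q)// (le_lt_trans _ U2e)// ler_piMr// oi_norm_ge0.
Qed.

Lemma adjointD X Y (S T : bop X Y) : adjoint (S + T) = adjoint S + adjoint T.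
Proof. by apply: bop_eq => f; apply: bop_eq => x; exact: bopD. Qed.

(** Here the normalised factor acts on the maximum norm instead of mapping into it, so its bound
    becomes 2, whence the constant [2 * c]. *)
Lemma small_KAdD : exists2 c : R, 0 < c & forall X Y (S T : bop X Y) d e,
  small_KAd S d -> small_KAd T e -> small_KAd (S + T) (c * (d + e)).
Proof.
have [c c1 cD] := oi_normD A; have c0 : 0 < c by exact: lt_le_trans c1.
exists (2 * c) => [|X Y S T d e]; first by rewrite mulr_gt0.
move=> [Z1 [U1 [V1 [U1c AV1 -> U11 V1d]]]] [Z2 [U2 [V2 [U2c AV2 -> U21 V2e]]]].
have [Z [i [j [p [q [[pi qj pj qi] [i1 j1] [p1 q1] Zle]]]]]] := exists_biproduct Z1 Z2.
have pz x : p (i (V1 x) + j (V2 x)) = V1 x.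
  by rewrite bopD -[p (i _)]/(bcomp p i _) -[p (j _)]/(bcomp p j _) pi pj addr0.
have qz x : q (i (V1 x) + j (V2 x)) = V2 x.
  by rewrite bopD -[q (i _)]/(bcomp q i _) -[q (j _)]/(bcomp q j _) qi qj add0r.
have [AV1i aV1i] := ideal_r (adjoint i) AV1; have [AV2j aV2j] := ideal_r (adjoint j) AV2.
have -> : bcomp U1 V1 + bcomp U2 V2 =
    bcomp (bcomp U1 p + bcomp U2 q) (bcomp i V1 + bcomp j V2).
  apply: bop_eq => x.
  rewrite -[RHS]/(U1 (p (i (V1 x) + j (V2 x))) + U2 (q (i (V1 x) + j (V2 x)))).
  by rewrite pz qz.
have sum_le : opnorm (bcomp U1 p + bcomp U2 q) <= 2.
  rewrite (le_trans (opnormD _ _))// (_ : 2 = 1 + 1)// lerD//.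
    by rewrite (le_trans (opnorm_comp _ _))// mulr_ile1 ?opnorm_ge0.
  by rewrite (le_trans (opnorm_comp _ _))// mulr_ile1 ?opnorm_ge0.
have AV : oi_mem A (adjoint (bcomp i V1 + bcomp j V2)).
  by rewrite adjointD !adjoint_comp; exact: oi_add.
apply: small_KAd_mul => //.
  by apply: compactD; exact: compact_comp_r.
rewrite (@le_lt_trans _ _ (2 * a (adjoint (bcomp i V1 + bcomp j V2))))//.
  by rewrite ler_wpM2r ?oi_norm_ge0.
rewrite -mulrA ltr_pM2l// adjointD !adjoint_comp.
rewrite (le_lt_trans (cD _ _ _ _ AV1i AV2j))// ltr_pM2l// ltrD//.
  rewrite (le_lt_trans aV1i)// (le_lt_trans _ V1d)// ler_piMr ?oi_norm_ge0//.
  by rewrite (le_trans (opnorm_adjoint _)).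
rewrite (le_lt_trans aV2j)// (le_lt_trans _ V2e)// ler_piMr ?oi_norm_ge0//.
by rewrite (le_trans (opnorm_adjoint _)).
Qed.

Lemma small_AK_rank1 X Y (f : dual X) (y : Y) e :
  nrm y * nrm f < e -> small_AK (rank1 f y) e.
Proof.
move=> fye; have [Ay ay] := ideal_line y.
apply: small_AK_mul => //; first exact: compact_functional.
by rewrite (le_lt_trans _ fye)// nrm_bop ler_wpM2r ?opnorm_ge0.
Qed.

Lemma small_KAd_rank1 X Y (f : dual X) (y : Y) e :
  nrm f * nrm y < e -> small_KAd (rank1 f y) e.
Proof.
move=> fye; have [Af af] := ideal_line f.
have [Af' af'] := ideal_r (kappa (sline R k) 1) Af.
apply: small_KAd_mul => //; first exact: compact_line.
  by rewrite adjoint_functional.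
rewrite adjoint_functional (le_lt_trans _ fye)// mulrC.
rewrite ler_pM ?oi_norm_ge0 ?opnorm_ge0 ?opnorm_line//.
by rewrite (le_trans af')// -nrm_bop nrm_kappa [X in _ * X]sabs1 mulr1.
Qed.

(** The order of the quantifiers matters: [d] depends on the vectors but not on the functionals, so
    the latter can be chosen afterwards by Goldstine's theorem. Iterating the quasi-triangle
    inequality is harmless as the list is fixed. *)
Lemma small_AK_sum X Y (I : Type) (s : seq I) (y : I -> Y) (e : R) : 0 < e ->
  exists2 d : R, 0 < d & forall f : I -> dual X, (forall i, nrm (f i) <= d) ->
    small_AK (\sum_(i <- s) rank1 (f i) (y i)) e.
Proof.
have [c c0 cD] := small_AKD.
elim: s e => [|i s IH] e e0.
  exists 1 => // f _; rewrite big_nil.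
  have -> : 0 = rank1 0 0 :> bop X Y by apply: bop_eq => x; rewrite rank1E scaler0.
  by apply: small_AK_rank1; rewrite nrm0 mul0r.
have e' : 0 < e / c / 2 by rewrite !divr_gt0.
have [d d0 dP] := IH _ e'.
have y0 : 0 < nrm (y i) + 1 by rewrite ltr_wpDl ?nrm_ge0.
exists (Num.min d (e / c / 2 / (nrm (y i) + 1))) => [|f fd].
  by rewrite lt_min d0 divr_gt0.
have {}fd j : nrm (f j) <= d /\ nrm (f j) <= e / c / 2 / (nrm (y i) + 1).
  by have := fd j; rewrite le_min => /andP.
rewrite big_cons (_ : e = c * (e / c / 2 + e / c / 2)); last first.
  by rewrite -splitr mulrC divfK ?gt_eqF.
apply: cD; last by apply: dP => j; exact: (fd j).1.
apply: small_AK_rank1; have := (fd i).2; rewrite ler_pdivlMr// => fi.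
have [->|/eqP f0] := pselect (f i = 0); first by rewrite nrm0 mulr0.
by rewrite (lt_le_trans _ fi)// mulrC ltr_pM2l ?nrm_gt0// ltrDl.
Qed.

(** The counterpart with the functionals fixed; the vectors, later the errors in approximating
    functionals on W, are chosen after [d]. *)
Lemma small_KAd_sum X Y (I : Type) (s : seq I) (f : I -> dual X) (e : R) : 0 < e ->
  exists2 d : R, 0 < d & forall y : I -> Y, (forall i, nrm (y i) <= d) ->
    small_KAd (\sum_(i <- s) rank1 (f i) (y i)) e.
Proof.
have [c c0 cD] := small_KAdD.
elim: s e => [|i s IH] e e0.
  exists 1 => // y _; rewrite big_nil.
  have -> : 0 = rank1 0 0 :> bop X Y by apply: bop_eq => x; rewrite rank1E scaler0.
  by apply: small_KAd_rank1; rewrite nrm0 mul0r.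
have e' : 0 < e / c / 2 by rewrite !divr_gt0.
have [d d0 dP] := IH _ e'.
have f0 : 0 < nrm (f i) + 1 by rewrite ltr_wpDl ?nrm_ge0.
exists (Num.min d (e / c / 2 / (nrm (f i) + 1))) => [|y yd].
  by rewrite lt_min d0 divr_gt0.
have {}yd j : nrm (y j) <= d /\ nrm (y j) <= e / c / 2 / (nrm (f i) + 1).
  by have := yd j; rewrite le_min => /andP.
rewrite big_cons (_ : e = c * (e / c / 2 + e / c / 2)); last first.
  by rewrite -splitr mulrC divfK ?gt_eqF.
apply: cD; last by apply: dP => j; exact: (yd j).1.
apply: small_KAd_rank1; have := (yd i).2; rewrite ler_pdivlMr// => yi.
have [->|/eqP y0] := pselect (y i = 0); first by rewrite nrm0 mulr0.
by rewrite (lt_le_trans _ yi)// mulrC ltr_pM2l ?nrm_gt0// ltrDl.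
Qed.

Lemma small_AKN X Y (T : bop X Y) e : small_AK T e -> small_AK (- T) e.
Proof.
move=> [Z [U [V [AU Vc -> V1 Ue]]]]; exists Z, U, (- V); split=> //.
- have -> : - V = bcomp (- bid Z) V by exact: bop_eq.
  exact: compact_comp_l.
- apply: bop_eq => x; apply/esym.
  by have := bopB U 0 (V x); rewrite bop0 !sub0r.
- by rewrite opnormN.
Qed.

End IdealCalculus.

(** * Duality for the approximation property *)

Section Preadjoints.
Context {R : realType} {k : scalar_kind}.
Implicit Types X Y Z W : Banach R k.

Lemma adjoint_rank1 X Y (f : dual X) (y : Y) :
  adjoint (rank1 f y) = rank1 (kappa Y y) f.
Proof.
apply: bop_eq => g; apply: bop_eq => x.
by rewrite adjointE rank1E bopZ; exact: mulrC.
Qed.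

Lemma adjointB X Y (S T : bop X Y) : adjoint (S - T) = adjoint S - adjoint T.
Proof. by apply: bop_eq => f; apply: bop_eq => x; exact: bopB. Qed.

Lemma adjoint_sum X Y (I : Type) (s : seq I) (F : I -> bop X Y) :
  adjoint (\sum_(i <- s) F i) = \sum_(i <- s) adjoint (F i).
Proof.
elim: s => [|i s IH]; last by rewrite !big_cons adjointD IH.
by rewrite !big_nil; apply: bop_eq => f; apply: bop_eq => x; exact: bop0.
Qed.

Lemma finite_rank_sum_map X Y (I : Type) (s : seq I) (f : I -> dual X) (y : I -> Y) :
  finite_rank (\sum_(i <- s) rank1 (f i) (y i)).
Proof.
have := finite_rank_sum [seq (f i, y i) | i <- s].
by rewrite big_map.
Qed.

Lemma admissibleS (E : Banach R k) (Q K : set E) Z (i : bop Z E) :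
  Q `<=` K -> admissible K i -> admissible Q i.
Proof. by move=> QK [inj ic Ki dens]; split=> //; exact: subset_trans Ki. Qed.

Lemma totally_bounded_bigcup X n (Q : 'I_n -> set X) :
  (forall j, totally_bounded (Q j)) -> totally_bounded [set x | exists j, Q j x].
Proof.
move=> Qt e e0; have /choice[s sP] j := Qt j _ e0.
exists (flatten [seq s j | j : 'I_n]) => x [j /sP[y ys xy]].
by exists y => //; apply/flattenP; exists (s j) => //; exact: codom_f.
Qed.

(* If [i] factors the adjoint of [U], the closure of [adjoint i \o kappa Z] being all of
   [dual W] makes [adjoint J] take its values in [kappa Y]. *)
Lemma preadjoint Z Y W (U : bop Z Y) (i : bop W (dual Z)) (J : bop (dual Y) W)
    (K : set (dual Z)) :
  admissible K i -> bcomp i J = adjoint U -> opnorm J <= 1 ->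
  exists2 P : bop (dual W) Y, bcomp (kappa Y) P = adjoint J & opnorm P <= 1.
Proof.
move=> [_ ic _ dens] iJ J1.
have [g|P PJ P1] := @lift_kappa _ _ _ Y (adjoint J); last first.
  by exists P => //; rewrite (le_trans P1)// (le_trans (opnorm_adjoint _)).
apply: kappa_closed => e e0; have e3 : 0 < e / 3 by rewrite divr_gt0.
have [f fg] := dens g _ e3.
have [z _ zf] := goldstine f ((compact_opP i).1 ic) e3.
exists (U z); rewrite (@le_lt_trans _ _ (e / 3 + e / 3))//; last by lra.
rewrite nrm_bop; apply: opnorm_ler_ball => phi phi1.
have Jphi : unit_ball W (J phi).
  apply/unit_ballE; rewrite (le_trans (ler_nrm_bop _ _))//.
  by rewrite (le_trans _ J1)// ler_piMr ?opnorm_ge0.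
change (nrm (g (J phi) - adjoint U phi z) <= e / 3 + e / 3).
rewrite -iJ (le_trans (nrm_triangle (f (i (J phi))) _ _))// lerD//.
  by rewrite nrmBC ltW// fg.
by apply: zf; exists (J phi).
Qed.

End Preadjoints.

(** * The two implications and the equivalent form of the extra condition *)

Section DualClass.
Context {R : realType} {k : scalar_kind} (A : operator_ideal R k) (X : Banach R k).

Lemma dual_class_dense : approximation_property A (dual X) ->
  forall Y : Banach R k,
    comp_class compact_op (dual_class A) X Y `<=` finite_rank_closure A X Y.
Proof.
move=> AP Y T [Z [U [V [Uc AV TE]]]] e e0.
have /compact_opP Ct := schauder Uc.
(* Total boundedness of the preimage of [C] in [W0] is what makes [J0] compact. *)
have [W0 [i0 [[inj0 i0c Ci0 _] i0t]]] := admissible_exists Ct.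
have [|J0 i0J0 J01] := @lift_unit_ball _ _ _ _ _ i0 (adjoint U) inj0.
  move=> f /unit_ballE f1; have [|w /unit_ballE w1 wf] := Ci0 (adjoint U f); first by exists f.
  by exists w.
have J0c : compact_op _ _ J0.
  apply/compact_opP; apply: totally_boundedS i0t => _ [f f1 <-]; exists f => //.
  by rewrite -i0J0.
(* Any space admissible for [K] contains the image of the unit ball of [W0] in that of its own ball,
   so [i0] factors through it. *)
pose K := closure (i0 @` unit_ball W0).
have Kc : compact K by rewrite /K -precompactE.
have [c c0 cD] := small_AKD A.
have e1 : 0 < e / c / 2 by rewrite !divr_gt0.
have [S [SK /finite_rankP[s SE]]] : [set S : bop (dual Z) (dual X) |
    (norm_on A K (S - adjoint V)%R < (e / c / 2)%:E)%E] `&` @finite_rank R k (dual Z) (dual X) !=set0.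
  apply: AP AV _ _; exists 1%N, (fun=> K), (e / c / 2); split=> // S _ /(_ ord0).
  by [].
have [_ [W [i [iK ->]]] /norm_AK_lt Sc] := ereal_inf_lt SK.
have [inj ic Ki dens] := iK.
have [|J1 iJ1 J11] := @lift_unit_ball _ _ _ _ _ i i0 inj.
  move=> w /unit_ballE w1; have [|v /unit_ballE v1 vw] := Ki (i0 w); last by exists v.
  by apply: subset_closure; exists w.
pose J := bcomp J1 J0.
have Jc : compact_op _ _ J := compact_comp_l J1 J0c.
have iJ : bcomp i J = adjoint U by rewrite bcompA iJ1.
have J_le1 : opnorm J <= 1.
  by rewrite (le_trans (opnorm_comp _ _))// mulr_ile1 ?opnorm_ge0.
have [d d0 dP] := small_AK_sum A W s (fun p => p.2) e1.
(* A functional [w] on [dual Z] is traded for a point of [Z], with an error measured on the totally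
   bounded image under [i] of the unit ball. *)
have /choice[z zP] (w : dual (dual Z)) :
    exists z : Z, nrm (bcomp (kappa Z z - w) i : dual W) <= d.
  have [z _ zw] := goldstine w ((compact_opP i).1 ic) d0; exists z.
  rewrite nrm_bop; apply: opnorm_ler_ball => v v1.
  change (nrm (i v z - w (i v)) <= d); rewrite nrmBC; apply: zw.
  by exists v => //; apply/unit_ballE.
pose F : bop X Z := \sum_(p <- s) rank1 p.2 (z p.1).
pose D := V - F.
have Dsmall : small_AK A (bcomp (adjoint D) i) e.
  have -> : bcomp (adjoint D) i =
      - (bcomp (S - adjoint V) i + \sum_(p <- s) rank1 (bcomp (kappa Z (z p.1) - p.1) i : dual W) p.2).
    have -> : \sum_(p <- s) rank1 (bcomp (kappa Z (z p.1) - p.1) i : dual W) p.2 =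
        bcomp (adjoint F - S) i.
      apply: bop_eq => w; rewrite sum_seqE.
      rewrite -[RHS]/(adjoint F (i w) - S (i w)) SE adjoint_sum !sum_seqE -sumrB.
      apply: eq_bigr => p _; rewrite adjoint_rank1 !rank1E -scalerBl.
      by [].
    rewrite /D adjointB; apply: bop_eq => w.
    change (adjoint V (i w) - adjoint F (i w) =
      - ((S (i w) - adjoint V (i w)) + (adjoint F (i w) - S (i w)))).
    by rewrite [S (i w) - _ + _]addrC addrA addrNK opprB.
  rewrite (_ : e = c * (e / c / 2 + e / c / 2)); last first.
    by rewrite -splitr mulrC divfK ?gt_eqF.
  by apply: small_AKN; apply: cD => //; apply: dP => p; exact: zP.
have {Dsmall}[Z' [U1 [V1 [AU1 V1c DE V11 U1e]]]] := Dsmall.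
have [V1t V1tE V1t1] := bidual_compact V1c.
pose Q : bop X (dual W) := bcomp (adjoint i) (bcomp (kappa Z) D).
(* By [DE], [Q x] is [U1' (kappa X x)] followed by [V1']. Hence [w (Q x)] is the value of [V1'' w]
   there, and [V1'' w] is the canonical image of [V1t w]. *)
have QE : adjoint Q = bcomp U1 V1t.
  apply: bop_eq => w; apply: bop_eq => x.
  have -> : adjoint Q w x = w (Q x) by [].
  have -> : Q x = adjoint V1 (adjoint U1 (kappa X x)).
    apply: bop_eq => v.
    have -> : Q x v = bcomp (adjoint D) i v x by [].
    by rewrite DE.
  have -> : w (adjoint V1 (adjoint U1 (kappa X x))) =
    adjoint (adjoint V1) w (adjoint U1 (kappa X x)) by [].
  by rewrite -V1tE.
have [P PE P1] := preadjoint iK iJ J_le1.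
have Pc : compact_op _ _ P.
  apply: (compact_isometry (@nrm_kappa _ _ Y)); rewrite PE; exact: schauder.
have UD : bcomp U D = bcomp P Q.
  apply: bop_eq => x; apply: (@kappa_inj _ _ Y).
  have -> : kappa Y (bcomp P Q x) = bcomp (kappa Y) P (Q x) by [].
  rewrite PE; apply: bop_eq => f.
  have -> : adjoint J (Q x) f = bcomp i J f (D x) by [].
  by rewrite iJ.
exists (\sum_(p <- s) rank1 p.2 (U (z p.1))); first exact: finite_rank_sum_map.
apply/norm_KAd_lt; exists (dual W), P, Q; split=> //.
- rewrite QE; exact: (ideal_r V1t AU1).1.
- rewrite -UD TE; apply: bop_eq => x.
  change (U (V x) - (\sum_(p <- s) rank1 p.2 (U (z p.1)) : bop X Y) x = U (V x - F x)).
  rewrite bopB; congr (_ - _).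
  rewrite sum_seqE /F sum_seqE (big_morph U (bopD U) (bop0 U)).
  by apply: eq_bigr => p _; rewrite !rank1E bopZ.
- rewrite QE (le_lt_trans (ideal_r V1t AU1).2)// (le_lt_trans _ U1e)//.
  by rewrite ler_piMr ?oi_norm_ge0// (le_trans V1t1).
Qed.

Lemma approximation_of_dual_class : subclass A (dual_class (dual_class A)) ->
  (forall Y : Banach R k,
    comp_class compact_op (dual_class A) X Y `<=` finite_rank_closure A X Y) ->
  approximation_property A (dual X).
Proof.
move=> Add dens Y T AT N [n [Q [e [Qc e0 QN]]]].
(* One space admissible for the union is admissible for every [Q j], so a single estimate controls
   all of them. *)
have Kt : totally_bounded [set y | exists j, Q j y].
  by apply: totally_bounded_bigcup => j; exact: compact_totally_bounded.
have [W [i [iK _]]] := admissible_exists Kt.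
have [inj ic Ki iW] := iK.
have [c c0 cD] := small_KAdD A.
have e1 : 0 < e / c / 2 by rewrite !divr_gt0.
pose T0 : bop X (dual W) := bcomp (adjoint i) (bcomp (adjoint T) (kappa X)).
have [|S0 /finite_rankP[s S0E] /norm_KAd_lt S0e] := dens (dual W) T0 _ _ e1.
  exists (dual Y), (adjoint i), (bcomp (adjoint T) (kappa X)); split=> //.
    exact: schauder.
  rewrite /dual_class/= adjoint_comp; apply: (ideal_l _ _).1.
  exact: Add AT.
have [d d0 dP] := small_KAd_sum A (dual W) s (fun p => p.1) e1.
(* The density clause of admissibility says that [adjoint i] has dense range. Through it the
   approximant of [T0] is replaced by one factoring through [adjoint i]. *)
have /choice[h hP] (g : dual W) : exists f : dual Y, nrm (g - adjoint i f) <= d.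
  have [f fg] := iW g d d0; exists f.
  rewrite nrm_bop; apply: opnorm_ler_ball => w w1.
  change (nrm (g w - f (i w)) <= d).
  by rewrite nrmBC ltW//; apply: fg; apply/unit_ballE.
pose S1 : bop X (dual Y) := \sum_(p <- s) rank1 p.1 (h p.2).
(* This is [S1' kappa_Y], written so that its finite rank is visible. *)
pose S : bop Y (dual X) := \sum_(p <- s) rank1 (h p.2) p.1.
have : small_KAd A (T0 - bcomp (adjoint i) S1) e.
  have -> : T0 - bcomp (adjoint i) S1 = (T0 - S0) +
      \sum_(p <- s) rank1 p.1 (p.2 - adjoint i (h p.2)).
    have -> : \sum_(p <- s) rank1 p.1 (p.2 - adjoint i (h p.2)) =
        S0 - bcomp (adjoint i) S1.
      apply: bop_eq => x; rewrite sum_seqE.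
      rewrite -[RHS]/(S0 x - adjoint i (S1 x)) S0E /S1 !sum_seqE.
      rewrite (big_morph (adjoint i) (bopD _) (bop0 _)) -sumrB.
      by apply: eq_bigr => p _; rewrite !rank1E bopZ -scalerBr.
    by rewrite addrA subrK.
  rewrite (_ : e = c * (e / c / 2 + e / c / 2)); last first.
    by rewrite -splitr mulrC divfK ?gt_eqF.
  by apply: cD => //; apply: dP => p; exact: hP.
move=> [M [P [V [Pc AV TSE P1 Ve]]]].
have Sfin : finite_rank S by exact: finite_rank_sum_map.
exists S; split=> //; apply: QN => [|j]; first exact: ideal_finite_rank.
apply: (@le_lt_trans _ _ (norm_AK A (bcomp (S - T) i))).
  apply: ereal_inf_lbound; exists W, i; split=> //.
  by apply: admissibleS iK => y Qy; exists j.
apply/norm_AK_lt.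
have -> : bcomp (S - T) i = - bcomp (adjoint V) (bcomp (adjoint P) (kappa W)).
  apply: bop_eq => w; apply: bop_eq => x.
  change (S (i w) x - T (i w) x = - (bcomp P V x w)).
  rewrite -TSE.
  change (S (i w) x - T (i w) x = - (T (i w) x - S1 x (i w))).
  rewrite opprB; congr (_ - _).
  rewrite /S /S1 sum_seqE sum_seqE !sum_seqE.
  by apply: eq_bigr => p _; exact: mulrC.
apply: small_AKN; exists (dual M), (adjoint V), (bcomp (adjoint P) (kappa W)).
split=> //; first by apply: compact_comp_r; exact: schauder.
rewrite (le_trans (opnorm_comp _ _))// mulr_ile1 ?opnorm_ge0 ?opnorm_kappa//.
by rewrite (le_trans (opnorm_adjoint _)).
Qed.

(** The bidual class always lies in the regular hull since [T'' kappa_Y = kappa_Z T]. Conversely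
    [(kappa_Z T)''] is in [A] under the inclusion, and the adjoint of the canonical embedding of Z'
    is a left inverse of [kappa_Z''], which recovers [T'']. The reverse implication holds because
    [A] lies in its regular hull. *)
Lemma subclass_dual_dual_reg :
  subclass A (dual_class (dual_class A)) <->
  eqclass (dual_class (dual_class A)) (reg_class A).
Proof.
split=> [Add Y Z|Areg Y Z T AT]; last first.
  by rewrite Areg; exact: (ideal_l _ AT).1.
apply/seteqP; split=> T.
  move=> AT; have -> : reg_class A T = oi_mem A (bcomp (adjoint (adjoint T)) (kappa Y)).
    by congr (oi_mem A _); apply: bop_eq => y; apply: bop_eq.
  exact: (ideal_r _ AT).1.
move=> /Add AT.
have : oi_mem A (bcomp (adjoint (kappa (dual Z))) (adjoint (adjoint (bcomp (kappa Z) T)))).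
  exact: (ideal_l _ AT).1.
congr (oi_mem A _); apply: bop_eq => w; apply: bop_eq => f.
by congr (w _); apply: bop_eq.
Qed.

End DualClass.

Theorem theorem6p5 (R : realType) (k : scalar_kind) (A : operator_ideal R k)
    (X : Banach R k) :
  (approximation_property A (dual X) ->
     forall Y : Banach R k,
       comp_class compact_op (dual_class A) X Y `<=` finite_rank_closure A X Y)
  /\
  (subclass A (dual_class (dual_class A)) <->
   eqclass (dual_class (dual_class A)) (reg_class A))
  /\
  (subclass A (dual_class (dual_class A)) ->
     (forall Y : Banach R k,
       comp_class compact_op (dual_class A) X Y `<=`
         finite_rank_closure A X Y) ->
     approximation_property A (dual X)).
Proof.
split; first exact: dual_class_dense.
split; first exact: subclass_dual_dual_reg.
exact: approximation_of_dual_class.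
Qed.
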